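(* Assume that $F$ is convex and $L$-smooth in the sense that $\|\nabla F(\mathbf y;\xi)-\nabla F(\mathbf x;\xi)\|\le L\|\mathbf x-\mathbf y\|$ for all $\mathbf x,\mathbf y\in\mathbb R^p$ and all $\xi$, and that $F$ is $\mu$-strongly convex with $\mu\ge 0$ (i.e. $F(\mathbf y)-F(\mathbf x)\ge\langle\nabla F(\mathbf x),\mathbf y-\mathbf x\rangle+\frac{\mu}{2}\|\mathbf x-\mathbf y\|^2$ for all $\mathbf x,\mathbf y\in\mathbb R^p$). Let $\mathbf y_0=\mathcal P_{\mathbf A^\perp}(\mathbf x_0)$, $\Delta^2=\mathbb E\|\mathbf y_0-\widetilde{\mathbf x}^*\|^2$ and $T=mS$. Run DP-SVRG for $S$ stages, where each stage has $m$ inner loops and performs projections at $\mathcal I_m$ with $\mathrm{gap}(\mathcal I_m)=E$. By choosing an appropriate constant step size $\eta_t^s=\eta=\Theta(\frac1{LE})$, the output $\hat{\mathbf y}$ satisfies: in the convex case $(\mu=0)$, $$\mathbb E[F(\hat{\mathbf y})-F(\widetilde{\mathbf x}^* )]=O\Big(\frac{LE\Delta^2}{T}+\frac{\mathbb E[F(\mathbf y_0)-F(\widetilde{\mathbf x}^* )]}{S}\Big),$$ and in the strongly convex case $(\mu>0)$, with condition number $\kappa=L/\mu$, $$\mathbb E[F(\hat{\mathbf y})-F(\widetilde{\mathbf x}^* )]\le O\Big(\big[LE\Delta^2+\mathbb E[F(\mathbf y_0)-F(\widetilde{\mathbf x}^* )]\big]\cdot\exp\Big(-\Theta\Big(\frac{T}{\max\{\kappa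 E,m\}}\Big)\Big)\Big).$$
   Context: Problem: minimize $F(\mathbf x)=\mathbb E_{\xi\sim\mathcal D}F(\mathbf x;\xi)$ over $\mathbf x\in\mathbb R^p$ subject to $\mathbf A^\top\mathbf x=\mathbf 0$, where $\mathbf A$ is a matrix such that this system has non-trivial solutions, and $\nabla F(\mathbf x)=\mathbb E_\xi\nabla F(\mathbf x;\xi)$. $\mathcal R(\mathbf A^\perp)=\{\mathbf x:\mathbf A^\top\mathbf x=\mathbf 0\}$ and $\mathcal P_{\mathbf A^\perp}$ is the orthogonal projection onto it. $\widetilde{\mathbf x}^*=\arg\min_{\mathbf x\in\mathcal R(\mathbf A^\perp)}F(\mathbf x)$ is the constrained minimizer. Norms are Euclidean. DP-SVRG (Delayed Projected SVRG), with projection set $\mathcal I_m\subset[m]=\{1,\dots,m\}$: initialize $\widetilde{\mathbf x}_0=\mathbf x_0^0=\mathcal P_{\mathbf A^\perp}(\mathbf x_0)$. For stages $s=0,\dots,S-1$: put $\widetilde{\mathbf h}_s=\mathcal P_{\mathbf A^\perp}(\nabla F(\widetilde{\mathbf x}_s))$; for $t=0,\dots,m-1$ sample $\xi_t^s\sim\mathcal D$ independently, set $\mathbf g_t^s=\nabla F(\mathbf x_t^s;\xi_t^s)-\nabla F(\widetilde{\mathbf x}_s;\xi_t^s)+\widetilde{\mathbf h}_s$ and $\mathbf x_{t+1}^s=\mathbf x_t^s-\eta_t^s\mathbf g_t^s$, and if $t+1\in\mathcal I_m$ replace $\mathbf x_{t+1}^s$ by $\mathcal P_{\mathbf A^\perp}(\mathbf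 x_{t+1}^s)$; at the end of the stage set $\mathbf x_0^{s+1}=\mathcal P_{\mathbf A^\perp}(\mathbf x_m^s)$ and $\widetilde{\mathbf x}_{s+1}=\mathcal P_{\mathbf A^\perp}\Big(\sum_{i=0}^{m-1}(1-\mu\eta)^i\mathbf x_{m-i-1}^s\Big/\sum_{j=0}^{m-1}(1-\mu\eta)^j\Big)$. Output: $\hat{\mathbf y}=\frac1S\sum_{s=1}^S\widetilde{\mathbf x}_s$ if $\mu=0$, and $\hat{\mathbf y}=\widetilde{\mathbf x}_S$ otherwise. $\mathrm{gap}(\mathcal I_m)$ is the largest interval between two consecutive elements of $\mathcal I_m$ when its elements are sorted; $E\ge1$. $O(\cdot)$ and $\Theta(\cdot)$ hide absolute constants.
   Formalization: Convexity is assumed of every sample function F(·;ξ), not only of the mean F, and gap(I_m) is taken over {0} ∪ I_m ∪ {m}, so that the first and last intervals of a stage count; without either change the claim is false. *)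

(* Defs.v *)
From HB Require Import structures.
From mathcomp Require Import all_boot all_order all_algebra.
From mathcomp Require Import finmap.
From mathcomp Require Import all_classical all_reals all_analysis.

Set Implicit Arguments.
Unset Strict Implicit.
Unset Printing Implicit Defensive.

Import Order.TTheory GRing.Theory Num.Theory.
Import numFieldNormedType.Exports.

Local Open Scope classical_set_scope.
Local Open Scope ring_scope.

Section Euclidean.
Context {R : realType} {p : nat}.
Implicit Types (u v x y : 'cV[R]_p) (f : 'cV[R]_p -> R).

Definition dotv u v : R := \sum_(i < p) u i 0 * v i 0.

(* The norm that the library puts on matrices is the sup norm. The two norms
   are equivalent, so [differentiable] and ['D_v] below are unaffected. *)
Definition enorm u : R := Num.sqrt (dotv u u).

Definition grad f x : 'cV[R]_p := \col_i 'D_(delta_mx i 0) f x.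

Definition lipschitz_grad (L : R) f :=
  forall x y, enorm (grad f y - grad f x) <= L * enorm (x - y).

Definition strongly_convex (mu : R) f :=
  forall x y, f y - f x >=
    dotv (grad f x) (y - x) + mu / 2 * enorm (x - y) ^+ 2.

End Euclidean.

Section Constraint.
Context {R : realType} {p n : nat}.
Variable A : 'M[R]_(p, n).

Definition feasible (x : 'cV[R]_p) := A^T *m x = 0.

(* Projection onto ker A^T along the column space of A, its orthogonal
   complement. The transposes are there because the row space theory of
   [mxalgebra] acts on row vectors. *)
Definition orth_proj (x : 'cV[R]_p) : 'cV[R]_p :=
  (x^T *m proj_mx (kermx A) <<A^T>>%MS)^T.

Lemma orth_proj_feasible x : feasible (orth_proj x).
Proof.
rewrite /feasible /orth_proj -trmx_mul; apply: (canLR trmxK).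
by rewrite trmx0; apply/sub_kermxP; exact: proj_mx_sub.
Qed.

Lemma kermx_colspace_disjoint : (kermx A :&: <<A^T>>)%MS = 0.
Proof.
apply/eqP/rowV0P => v; rewrite sub_capmx genmxE.
move=> /andP[/sub_kermxP vA /submxP[y vE]].
have /matrixP/(_ 0 0) : v *m v^T = 0.
  by rewrite [in v^T]vE trmx_mul trmxK mulmxA vA mul0mx.
rewrite !mxE => v0; apply/rowP => i; rewrite mxE; apply/eqP.
have /eqP := v0; rewrite psumr_eq0 => [/allP/(_ i)|j _]; rewrite ?mxE.
  by rewrite mem_index_enum mulf_eq0 orbb => /(_ isT).
by rewrite -expr2 sqr_ge0.
Qed.

Lemma orth_proj_orthogonal x z :
  feasible z -> dotv (x - orth_proj x) z = 0.
Proof.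
move=> zA.
have full : (x^T <= kermx A + <<A^T>>)%MS.
  apply: submx_full; rewrite /row_full.
  have := mxrank_sum_cap (kermx A) <<A^T>>%MS.
  rewrite kermx_colspace_disjoint mxrank0 addn0 => ->.
  by rewrite genmxE mxrank_tr mxrank_ker subnK// rank_leq_row.
have := proj_mx_compl_sub full; rewrite genmxE => /submxP[y yE].
have <- : ((x - orth_proj x)^T *m z) 0 0 = dotv (x - orth_proj x) z.
  by rewrite mxE; apply: eq_bigr => i _; rewrite mxE.
by rewrite linearB /= /orth_proj trmxK yE -mulmxA zA mulmx0 mxE.
Qed.

Definition constrained_minimizer (f : 'cV[R]_p -> R) (xs : 'cV[R]_p) :=
  feasible xs /\ forall x, feasible x -> f xs <= f x.

End Constraint.

Section Objective.
Context {R : realType} {p : nat} d (Xi : measurableType d).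
Variables (D : probability Xi R) (F : 'cV[R]_p -> Xi -> R).

Definition objective (x : 'cV[R]_p) : R := \int[D]_z F x z.

Definition gradF (x : 'cV[R]_p) (z : Xi) : 'cV[R]_p := grad (F^~ z) x.

Definition stochastic_objective : Prop :=
  [/\ forall z x, differentiable (F^~ z) x,
      forall x, D.-integrable setT (fun z => (F x z)%:E),
      forall x, differentiable objective x,
      forall x i, D.-integrable setT (fun z => (gradF x z i 0)%:E) &
      forall x, grad objective x = \col_i \int[D]_z gradF x z i 0].

End Objective.

Definition gap (I : seq nat) : nat :=
  let r := sort leq I in
  \max_(i < (size r).-1) (nth 0 r i.+1 - nth 0 r i).

(* Besides the times in [I], a stage of length m projects its initial point
   (time 0) and its final point (time m). *)
Definition stage_gap (m : nat) (I : seq nat) : nat := gap (0 :: m :: I).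

Section DPSVRG.
Context {R : realType} {p : nat} {Xi : Type}.
Variable Proj : 'cV[R]_p -> 'cV[R]_p.
Variables (g : 'cV[R]_p -> Xi -> 'cV[R]_p) (gbar : 'cV[R]_p -> 'cV[R]_p).
Variables (mu eta : R) (m : nat) (I : seq nat).

Fixpoint inner_iterate (anchor start : 'cV[R]_p) (z : nat -> Xi) (t : nat)
    : 'cV[R]_p :=
  if t isn't t'.+1 then start else
  let x := inner_iterate anchor start z t' in
  let x' := x - eta *: (g x (z t') - g anchor (z t') + Proj (gbar anchor)) in
  if t'.+1 \in I then Proj x' else x'.

Definition next_anchor (anchor start : 'cV[R]_p) (z : nat -> Xi) : 'cV[R]_p :=
  Proj ((\sum_(j < m) (1 - mu * eta) ^+ j)^-1 *:
    \sum_(i < m)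
      (1 - mu * eta) ^+ i *: inner_iterate anchor start z (m - i - 1)%N).

Definition next_start (anchor start : 'cV[R]_p) (z : nat -> Xi) : 'cV[R]_p :=
  Proj (inner_iterate anchor start z m).

(* The pair (anchor point, initial inner iterate) of stage s; [z s t] is the
   sample drawn at step t of stage s. *)
Fixpoint stage (x0 : 'cV[R]_p) (z : nat -> nat -> Xi) (s : nat)
    : 'cV[R]_p * 'cV[R]_p :=
  if s isn't s'.+1 then (Proj x0, Proj x0) else
  let q := stage x0 z s' in
  (next_anchor q.1 q.2 (z s'), next_start q.1 q.2 (z s')).

Definition dpsvrg (x0 : 'cV[R]_p) (z : nat -> nat -> Xi) (S : nat)
    : 'cV[R]_p :=
  if mu == 0 then S%:R^-1 *: \sum_(1 <= s < S.+1) (stage x0 z s).1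
  else (stage x0 z S).1.

End DPSVRG.

Section Independence.
Context d (Om : measurableType d) (R : realType) (P : probability Om R).

Definition mutually_independent (I : choiceType) (J : set I)
    (G : I -> set_system Om) : Prop :=
  forall (K : {fset I}) (B : I -> set Om),
    [set` K] `<=` J -> (forall i, i \in K -> G i (B i)) ->
    fine (P (\bigcap_(i in [set` K]) B i)) = \prod_(i <- K) fine (P (B i)).

Definition random_vector (p : nat) (X : Om -> 'cV[R]_p) : Prop :=
  forall i, measurable_fun setT (fun w => X w i 0).

(* The sigma-algebra generated by the initial point (index [None]) and those
   generated by the samples (index [Some (s, t)]). *)
Definition dpsvrg_sigma_algebras (p : nat) d' (Xi : measurableType d')
    (x0 : Om -> 'cV[R]_p) (z : nat -> nat -> Om -> Xi)
    (i : option (nat * nat)) : set_system Om :=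
  if i is Some (s, t) then preimage_set_system setT (z s t) measurable
  else g_sigma_preimage (fun (j : 'I_p) w => x0 w j 0).

(* The samples of the run, z s t for s < S and t < m, have law D and are
   independent of one another and of the initial point. *)
Definition dpsvrg_sampling (p : nat) d' (Xi : measurableType d')
    (D : probability Xi R) (S m : nat)
    (x0 : Om -> 'cV[R]_p) (z : nat -> nat -> {RV P >-> Xi}) : Prop :=
  [/\ random_vector x0,
      forall s t, (s < S)%N -> (t < m)%N ->
        forall B, measurable B -> distribution P (z s t) B = D B &
      mutually_independent
        [set i : option (nat * nat) |
          if i is Some (s, t) then (s < S)%N && (t < m)%N else true]
        (dpsvrg_sigma_algebras x0 (fun s t => z s t))].

End Independence.

(* Main.v *)
(* Split an iterate x into its feasible part Px and its infeasibility x - Px. The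
   feasible part performs projected SVRG with gradients taken at x instead of Px, so
   smoothness costs it a multiple of |x - Px|^2 per step; the infeasibility is reset
   at each projection and in between accumulates at most E noise terms, whose variance
   co-coercivity bounds by |x - Px|^2 and the suboptimality gaps of Px and of the
   anchor. Hence, for eta of order 1 / (L E), the function
     Phi_t(x) = |Px - x_opt|^2 + c_t |x - Px|^2,
   with c_t decreasing geometrically in the time since the last projection, satisfies,
   in conditional expectation given the past,
     Phi_(t+1) + 3/2 eta (F(Px_t) - F_opt)
       <= (1 - mu eta) Phi_t + 1/2 eta (F(anchor) - F_opt).
   Unrolling over a stage with the weights that define the next anchor and using
   convexity, |start - x_opt|^2 and F(anchor) - F_opt obey a recursion that telescopes over
   the stages if mu = 0, and contracts by max((1 - mu eta)^m, 1/3) otherwise.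
   All quantities whose expectation is taken are nonnegative, so the conditional
   expectations reduce to Tonelli's theorem for one sample independent of all others. *)
Require Import Defs.
From HB Require Import structures.
From mathcomp Require Import all_boot all_order all_algebra.
From mathcomp Require Import finmap.
From mathcomp Require Import all_classical all_reals all_analysis.
From mathcomp Require Import measurable_realfun.
From mathcomp Require Import ring lra.

Import Order.TTheory GRing.Theory Num.Theory.
Import numFieldNormedType.Exports.

Set Implicit Arguments.
Unset Strict Implicit.
Unset Printing Implicit Defensive.

Local Open Scope classical_set_scope.
Local Open Scope ring_scope.

(** * Smooth convex functions on Euclidean space *)

Section EuclideanTheory.
Context {R : realType} {p : nat}.
Implicit Types (u v w x y : 'cV[R]_p) (f : 'cV[R]_p -> R).

Lemma dotvC u v : dotv u v = dotv v u.
Proof. by apply: eq_bigr => i _; rewrite mulrC. Qed.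

Lemma dotvDl u v w : dotv (u + v) w = dotv u w + dotv v w.
Proof. by rewrite -big_split; apply: eq_bigr => i _; rewrite mxE mulrDl. Qed.

Lemma dotvZl a u v : dotv (a *: u) v = a * dotv u v.
Proof. by rewrite /dotv mulr_sumr; apply: eq_bigr => i _; rewrite mxE mulrA. Qed.

Lemma dotvNl u v : dotv (- u) v = - dotv u v.
Proof. by rewrite -scaleN1r dotvZl mulN1r. Qed.

Lemma dotvDr u v w : dotv u (v + w) = dotv u v + dotv u w.
Proof. by rewrite dotvC dotvDl !(dotvC u). Qed.

Lemma dotvZr a u v : dotv u (a *: v) = a * dotv u v.
Proof. by rewrite dotvC dotvZl dotvC. Qed.

Lemma dotvNr u v : dotv u (- v) = - dotv u v.
Proof. by rewrite dotvC dotvNl dotvC. Qed.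

Lemma dotv0l u : dotv 0 u = 0.
Proof. by rewrite -(scale0r 0) dotvZl mul0r. Qed.

Lemma dotv0r u : dotv u 0 = 0.
Proof. by rewrite dotvC dotv0l. Qed.

Definition dotvE := (dotvDl, dotvDr, dotvNl, dotvNr, dotvZl, dotvZr).

Lemma dotv_ge0 u : 0 <= dotv u u.
Proof. by apply: sumr_ge0 => i _; rewrite -expr2 sqr_ge0. Qed.

Lemma sqr_enorm u : enorm u ^+ 2 = dotv u u.
Proof. by rewrite /enorm sqr_sqrtr// dotv_ge0. Qed.

Lemma enorm_ge0 u : 0 <= enorm u.
Proof. exact: sqrtr_ge0. Qed.

Lemma enormN u : enorm (- u) = enorm u.
Proof. by rewrite /enorm dotvNl dotvNr opprK. Qed.

Lemma enormZ a u : enorm (a *: u) = `|a| * enorm u.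
Proof.
by rewrite /enorm dotvZl dotvZr mulrA -expr2 sqrtrM ?sqr_ge0// sqrtr_sqr.
Qed.

Lemma enorm_distC u v : enorm (u - v) = enorm (v - u).
Proof. by rewrite -enormN opprB. Qed.

Lemma dotv_eq0 u : dotv u u = 0 -> u = 0.
Proof.
move=> /eqP; rewrite psumr_eq0 => [/allP u0|i _]; last by rewrite -expr2 sqr_ge0.
apply/colP => i; rewrite mxE; apply/eqP.
by have := u0 i; rewrite mem_index_enum -expr2 sqrf_eq0 => /(_ isT).
Qed.

(** Cauchy-Schwarz: the squared norm of [dotv v v *: u - dotv u v *: v] is [dotv v v] times the
    difference of the two sides. *)
Lemma sqr_dotv_le u v : dotv u v ^+ 2 <= dotv u u * dotv v v.
Proof.
have [v0|v_neq0] := eqVneq (dotv v v) 0.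
  by rewrite (dotv_eq0 v0) !dotv0r mulr0 expr0n.
have v_gt0 : 0 < dotv v v by rewrite lt_def v_neq0 dotv_ge0.
have := dotv_ge0 (dotv v v *: u - dotv u v *: v).
rewrite !dotvE (dotvC v u).
rewrite (_ : _ + _ = dotv v v * (dotv u u * dotv v v - dotv u v ^+ 2)); last ring.
by rewrite pmulr_rge0// subr_ge0.
Qed.

Lemma dotv_le u v : dotv u v <= enorm u * enorm v.
Proof.
have := sqr_dotv_le u v; rewrite -!sqr_enorm -exprMn => le_sqr.
apply: (le_trans (ler_norm _)).
by rewrite -(@ler_pXn2r _ 2) ?nnegrE ?mulr_ge0 ?enorm_ge0// real_normK ?num_real.
Qed.

Lemma le_enorm u i : u i 0 <= enorm u.
Proof.
apply: (le_trans (ler_norm _)).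
rewrite -(@ler_pXn2r _ 2) ?nnegrE ?enorm_ge0// sqr_enorm real_normK ?num_real//.
rewrite /dotv (bigD1 i)//= -expr2 lerDl sumr_ge0// => j _.
by rewrite -expr2 sqr_ge0.
Qed.

(** Young's inequality: the two sides differ by [a^-1] times the squared norm of [a *: u - v]. *)
Lemma dotvD_le a u v : 0 < a ->
  dotv (u + v) (u + v) <= (1 + a) * dotv u u + (1 + a^-1) * dotv v v.
Proof.
move=> a0; have := dotv_ge0 (a *: u - v).
rewrite !dotvE (dotvC v u) => h; rewrite -subr_ge0.
have := mulr_ge0 (ltW a0 : 0 <= a) h => {}h.
have ai0 : 0 <= a^-1 by rewrite invr_ge0 ltW.
apply: (le_trans (mulr_ge0 ai0 (mulr_ge0 ai0 h))).
rewrite le_eqVlt; apply/orP; left; apply/eqP.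
by field; rewrite gt_eqF.
Qed.

(** The two sides differ by the sum of the squared norms of the three pairwise differences. *)
Lemma dotvD3_le u v w :
  dotv (u + v + w) (u + v + w) <= 3 * (dotv u u + dotv v v + dotv w w).
Proof.
have := dotv_ge0 (u - v); have := dotv_ge0 (u - w); have := dotv_ge0 (v - w).
rewrite !dotvE (dotvC v u) (dotvC w u) (dotvC w v); lra.
Qed.

Lemma dotv_sum (I : Type) (r : seq I) (Q : pred I) (h : I -> 'cV[R]_p) v :
  dotv (\sum_(i <- r | Q i) h i) v = \sum_(i <- r | Q i) dotv (h i) v.
Proof.
elim/big_rec2 : _ => [|i y1 y2 _ <-]; first exact: dotv0l.
by rewrite dotvDl.
Qed.

(** [grad] collects partial derivatives only; differentiability makes the derivative linear in the
    direction. *)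
Lemma derive_dotv_grad f x v : differentiable f x -> 'D_v f x = dotv (grad f x) v.
Proof.
move=> fx; rewrite deriveE//.
have {1}-> : v = \sum_i v i 0 *: delta_mx i 0.
  by rewrite {1}[v]matrix_sum_delta; apply: eq_bigr => i _; rewrite big_ord1.
rewrite linear_sum; apply: eq_bigr => i _.
by rewrite linearZ /= mxE deriveE// mulrC.
Qed.

Lemma is_derive_line f x v (t : R) : (forall x, differentiable f x) ->
  is_derive t 1 (fun s : R => f (x + s *: v)) (dotv (grad f (x + t *: v)) v).
Proof.
move=> df; rewrite -derive_dotv_grad//.
have quotE : (fun h : R => h^-1 *: ((f (x + (h *: 1 + t) *: v)) - f (x + t *: v)))
  = (fun h : R => h^-1 *: (f (h *: v + (x + t *: v)) - f (x + t *: v))).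
  apply/funext => h; congr (_ *: (f _ - _)).
  by rewrite scalerDl addrCA [h *: 1]mulr1.
have Df : derivable f (x + t *: v) v by exact: diff_derivable.
apply: DeriveDef.
  by move: Df; rewrite /derivable /= /comp -quotE.
by rewrite /derive /= /comp quotE.
Qed.

(** Along the segment from [x] to [y], [f] minus its quadratic model is nonincreasing, because
    Cauchy-Schwarz bounds the change of slope at time [t] by [L * t] times the squared length. Its
    values at 0 and 1 give the claim. *)
Lemma descent_lemma (L : R) f x y : (forall x, differentiable f x) ->
  0 <= L -> lipschitz_grad L f ->
  f y <= f x + dotv (grad f x) (y - x) + L / 2 * dotv (y - x) (y - x).
Proof.
move=> df L0 lf; set v := y - x.
pose c := dotv (grad f x) v; pose k := L / 2 * dotv v v.
pose h (t : R) := f (x + t *: v) + (- c * t + - k * (t * t)).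
have dh (t : R) : is_derive t 1 h
    (dotv (grad f (x + t *: v)) v + (- c - k * (t + t))).
  have := is_derive_line x v t df => dline.
  apply: is_deriveD; apply: is_derive_eq.
  by rewrite /GRing.scale /=; ring.
have hc : {within `[0, 1], continuous h}.
  by apply: derivable_within_continuous => t _; have [] := dh t.
have h_le (t : R) : t \in `]0, 1[ -> (derive1 h t) <= 0.
  rewrite in_itv /= => /andP[t0 _].
  rewrite derive1E (@derive_val _ _ _ _ _ _ _ (dh t)).
  have := lf (x + t *: v) x; rewrite enorm_distC => gl.
  have : dotv (grad f (x + t *: v) - grad f x) v <= L * (t * enorm v) * enorm v.
    apply: (le_trans (dotv_le _ _)); apply: ler_wpM2r; first exact: enorm_ge0.
    rewrite enorm_distC (le_trans (lf _ _))//.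
    by rewrite addrAC subrr add0r enormZ gtr0_norm.
  rewrite -mulrA -(mulrA t) -expr2 sqr_enorm dotvDl dotvNl -/c /k; lra.
have := @ler0_derive1_le_cc _ h 0 1 (fun t _ => @ex_derive _ _ _ _ _ _ _ (dh t))
  h_le hc 1 0.
rewrite !bound_itvE => /(_ ler01 ler01 ler01).
rewrite /h scale0r scale1r addr0 /v subrKC -/v; clear dh hc h_le h.
rewrite -/c -/k; lra.
Qed.

(** Unpacks [convex_function], whose weight is a bundled element of the unit interval. *)
Lemma convex_function_conv f x y (t : R) : convex_function setT f ->
  0 <= t -> t <= 1 -> f ((1 - t) *: x + t *: y) <= (1 - t) * f x + t * f y.
Proof.
move=> cf t0 t1.
have t01 : Itv.spec (@Itv.num_sem R) (Itv.Real `[0%Z, 1%Z]) t.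
  by rewrite /= /Itv.num_sem num_real /= in_itv /= t0 t1.
have := cf (Itv.mk t01) y x; rewrite !inE => /(_ I I).
rewrite (addrC (_ *: x)) (addrC (_ * f x)).
exact.
Qed.

(** By convexity the difference quotients along [y - x] with step in ]0, 1] are at most [f y - f x];
    let the step tend to 0 from the right. *)
Lemma convex_first_order f x y : (forall x, differentiable f x) ->
  convex_function setT f -> f x + dotv (grad f x) (y - x) <= f y.
Proof.
move=> df cf; rewrite addrC -lerBrDr -derive_dotv_grad//.
have Df : derivable f x (y - x) by exact: diff_derivable.
apply: (cvgr_to_le (cvg_dnbhs_at_right Df)).
near=> h.
have h0 : 0 < h by [].
have h1 : h <= 1 by near: h; apply: nbhs_right_le.
have := convex_function_conv x y cf (ltW h0) h1.
rewrite /= [_ *: (_ - _)](_ : _ = h^-1 * (f (h *: (y - x) + x) - f x))//.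
rewrite ler_pdivrMl//.
rewrite (_ : (1 - h) *: x + h *: y = h *: (y - x) + x); first lra.
by rewrite scalerBl scale1r scalerBr addrC addrCA addrC.
Unshelve. all: by end_near.
Qed.

(* Minimising the upper model of f at y along the direction of the gradient
   difference compares it with the lower model at x. *)
Lemma cocoercive (L : R) f x y : 0 < L ->
  (forall x y, f x + dotv (grad f x) (y - x) <= f y) ->
  (forall x y, f y <= f x + dotv (grad f x) (y - x) + L / 2 * dotv (y - x) (y - x)) ->
  dotv (grad f y - grad f x) (grad f y - grad f x) <=
    2 * L * (f y - f x - dotv (grad f x) (y - x)).
Proof.
move=> L0 lo up; set g := grad f y - grad f x.
have := lo x (y - L^-1 *: g); have := up y (y - L^-1 *: g).
rewrite (_ : y - L^-1 *: g - y = - (L^-1 *: g)); last by rewrite addrC addKr.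
rewrite (addrAC y) [dotv _ (y - x - _)]dotvDr !(dotvNr, dotvNl, dotvZl, dotvZr) opprK.
have gE : dotv g g = dotv (grad f y) g - dotv (grad f x) g.
  by rewrite {1}/g dotvDl dotvNl.
set dy := dotv (grad f y) g in gE *; set dx := dotv (grad f x) g in gE *.
rewrite (_ : L / 2 * (L^-1 * (L^-1 * dotv g g)) = L^-1 * dotv g g / 2).
  move=> h1 h2.
  have : L^-1 * dotv g g / 2 <= f y - f x - dotv (grad f x) (y - x).
    rewrite gE in h1 *; lra.
  rewrite -(ler_pM2l (_ : 0 < 2 * L)) ?mulr_gt0//.
  by rewrite (_ : 2 * L * (_ / 2) = dotv g g)//; field; rewrite gt_eqF.
by field; rewrite gt_eqF.
Qed.

End EuclideanTheory.

(** * Measurability and freezing of independent samples *)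

Lemma rat_dense_enorm (R : realType) (p : nat) (x : 'cV[R]_p) (e : R) : 0 < e ->
  exists v : 'cV[rat]_p, enorm (x - map_mx ratr v) < e.
Proof.
(* The successor keeps the denominator nonzero for [p = 0]; the coordinate errors then add up
   because p < (p + 1)^2. *)
move=> e0; pose dl := e / p.+1%:R.
have dl0 : 0 < dl by rewrite divr_gt0.
have /choice[q qP] : forall i : 'I_p, exists q : rat, `|x i 0 - ratr q| < dl.
  move=> i; have [q] := @rat_in_itvoo _ (x i 0 - dl) (x i 0 + dl) ltac:(lra).
  by rewrite in_itv /= => /andP[? ?]; exists q; rewrite ltr_norml; apply/andP; split; lra.
exists (\col_i q i); rewrite -(@ltr_pXn2r _ 2) ?nnegrE ?enorm_ge0 ?(ltW e0)//.
rewrite sqr_enorm; apply: (@le_lt_trans _ _ (\sum_(i < p) dl ^+ 2)).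
  apply: ler_sum => i _; rewrite !mxE -expr2 -real_normK ?num_real//.
  by rewrite ler_pXn2r ?nnegrE ?(ltW dl0)//; exact/ltW/qP.
rewrite sumr_const card_ord -mulr_natl expr_div_n mulrA ltr_pdivrMr ?exprn_gt0//.
rewrite mulrC ltr_pM2l ?exprn_gt0// -natrX ltr_nat expnS expn1 mulSn.
by rewrite (leq_trans (ltnSn p))// leq_addr.
Qed.

Section Measurability.
Context d (T : measurableType d) (R : realType).

(** [h] is a countable pointwise supremum, so its superlevel sets are countable unions of those of
    the [h_ v]. *)
Lemma measurable_fun_countable_sup (I : countType) (h_ : I -> T -> R) (h : T -> R) :
  (forall v, measurable_fun setT (h_ v)) -> (forall v t, h_ v t <= h t) ->
  (forall t e, 0 < e -> exists v, h t - e < h_ v t) -> measurable_fun setT h.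
Proof.
move=> mh_ h_le h_sup.
apply: (measurability _ (RGenOInfty.measurableE R)) => //= _ [_ [r ->] <-].
rewrite setTI (_ : _ @^-1` _ = \bigcup_v (h_ v @^-1` `]r, +oo[)).
  apply: countable_bigcupT_measurable => // v; rewrite -[X in measurable X]setTI.
  by apply: mh_ => //; exact: measurable_itv.
apply/seteqP; split=> [t|t [v _]] /=; rewrite !in_itv /= !andbT; last first.
  by move=> /lt_le_trans; apply.
move=> rh; have [|v hv] := h_sup t (h t - r); first by rewrite subr_gt0.
by exists v => //=; rewrite in_itv /= andbT; lra.
Qed.

Context {p : nat}.
Implicit Types X Y : T -> 'cV[R]_p.

Lemma random_vector_cst (v : 'cV[R]_p) : random_vector (fun _ : T => v).
Proof. by move=> i. Qed.

Lemma random_vectorD X Y : random_vector X -> random_vector Y ->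
  random_vector (fun t => X t + Y t).
Proof.
move=> mX mY i; rewrite (_ : (fun _ => _) = (fun t => X t i 0 + Y t i 0)).
  exact: measurable_funD.
by apply/funext => t; rewrite mxE.
Qed.

Lemma random_vectorZ a X : random_vector X -> random_vector (fun t => a *: X t).
Proof.
move=> mX i; rewrite (_ : (fun _ => _) = (fun t => a * X t i 0)).
  exact: measurable_funM.
by apply/funext => t; rewrite mxE.
Qed.

Lemma random_vectorB X Y : random_vector X -> random_vector Y ->
  random_vector (fun t => X t - Y t).
Proof.
move=> mX mY; apply: random_vectorD => //.
rewrite (_ : (fun _ => _) = (fun t => -1 *: Y t)); first exact: random_vectorZ.
by apply/funext => t; rewrite scaleN1r.
Qed.

Lemma random_vector_sum (I : Type) (s : seq I) (X : I -> T -> 'cV[R]_p) :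
  (forall i, random_vector (X i)) -> random_vector (fun t => \sum_(i <- s) X i t).
Proof.
move=> mX; elim: s => [|i s IHs].
  rewrite (_ : (fun _ => _) = (fun=> 0)); first exact: random_vector_cst.
  by apply/funext => t; rewrite big_nil.
rewrite (_ : (fun _ => _) = (fun t => X i t + \sum_(j <- s) X j t)).
  exact: random_vectorD.
by apply/funext => t; rewrite big_cons.
Qed.

Lemma random_vector_mulmx (M : 'M[R]_p) X : random_vector X ->
  random_vector (fun t => M *m X t).
Proof.
move=> mX i; rewrite (_ : (fun _ => _) = (fun t => \sum_j M i j * X t j 0)).
  by apply: measurable_sum => j; exact: measurable_funM.
by apply/funext => t; rewrite mxE.
Qed.

Lemma measurable_dotv X Y : random_vector X -> random_vector Y ->
  measurable_fun setT (fun t => dotv (X t) (Y t)).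
Proof. by move=> mX mY; apply: measurable_sum => j; exact: measurable_funM. Qed.

Lemma measurable_enorm X : random_vector X -> measurable_fun setT (fun t => enorm (X t)).
Proof.
move=> mX; apply: (measurableT_comp (f := @Num.sqrt R)).
  by apply: continuous_measurable_fun; exact: sqrt_continuous.
exact: measurable_dotv.
Qed.

(* The tangents at rational points of a convex function f recover f as a countable
   supremum: the gap at distance r is O(r^2) by smoothness. *)
Lemma measurable_fun_smooth_convex (f : 'cV[R]_p -> R) (L : R) X : 0 < L ->
  (forall x y, f x + dotv (grad f x) (y - x) <= f y) ->
  (forall x y, f y <= f x + dotv (grad f x) (y - x) + L / 2 * dotv (y - x) (y - x)) ->
  random_vector X -> measurable_fun setT (fun t => f (X t)).
Proof.
move=> L0 lo up mX.
pose h_ (v : 'cV[rat]_p) t := f (map_mx ratr v) +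
  dotv (grad f (map_mx ratr v)) (X t - map_mx ratr v).
apply: (measurable_fun_countable_sup (h_ := h_)) => [v|v t|t e e0].
- apply: measurable_funD => //; apply: measurable_dotv; first exact: random_vector_cst.
  by apply: random_vectorB => //; exact: random_vector_cst.
- exact: lo.
(* Within this radius r the gap [L / 2 * r ^+ 2] to the tangent stays below [e]. *)
- have [|v vP] := @rat_dense_enorm R p (X t) (Num.sqrt (2 * e / L)).
    by rewrite sqrtr_gt0 divr_gt0 ?mulr_gt0.
  exists v; have := up (map_mx ratr v) (X t); rewrite /h_.
  have : L / 2 * dotv (X t - map_mx ratr v) (X t - map_mx ratr v) < e.
    move: vP; rewrite -(@ltr_pXn2r _ 2) ?nnegrE ?enorm_ge0 ?sqrtr_ge0//.
    rewrite sqr_enorm sqr_sqrtr ?divr_ge0 ?mulr_ge0 ?ltW// => vP.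
    rewrite -(@ltr_pM2l _ (2 / L)) ?divr_gt0// mulrA.
    rewrite (_ : 2 / L * (L / 2) = 1) ?mul1r; last by field; rewrite gt_eqF.
    by rewrite mulrAC.
  lra.
Qed.

End Measurability.

(* McShane: a Lipschitz function is the supremum of countably many cones. *)
Lemma measurable_fun_lipschitz d (T : measurableType d) d' (Xi : measurableType d')
    (R : realType) (p : nat) (g : 'cV[R]_p -> Xi -> R) (L : R)
    (X : T -> 'cV[R]_p) (xi : T -> Xi) : 0 < L ->
  (forall v, measurable_fun setT (g v)) ->
  (forall u v z, g u z - g v z <= L * enorm (u - v)) ->
  random_vector X -> measurable_fun setT xi ->
  measurable_fun setT (fun t => g (X t) (xi t)).
Proof.
move=> L0 mg lip mX mxi.
pose h_ (v : 'cV[rat]_p) t :=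
  g (map_mx ratr v) (xi t) - L * enorm (X t - map_mx ratr v).
apply: (measurable_fun_countable_sup (h_ := h_)) => [v|v t|t e e0].
- apply: measurable_funB; first exact: measurableT_comp.
  apply: measurable_funM => //; apply: measurable_enorm.
  by apply: random_vectorB => //; exact: random_vector_cst.
- by have := lip (map_mx ratr v) (X t) (xi t); rewrite /h_ enorm_distC; lra.
(* Half of [e] pays for the slope of the cone, the other half for the variation of [g]. *)
- have [|v] := @rat_dense_enorm R p (X t) (e / L / 2); first by rewrite !divr_gt0.
  exists v; have := lip (X t) (map_mx ratr v) (xi t).
  have : L * enorm (X t - map_mx ratr v) < e / 2.
    by rewrite mulrC -ltr_pdivlMr// mulrAC.
  rewrite /h_; lra.
Qed.

Section Freezing.
Context d (Om : measurableType d) (R : realType) (P : probability Om R).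

(* By independence the joint law of the identity, seen as a map into Om with the
   sigma-algebra generated by G, and of xi is a product measure; apply Fubini. *)
Lemma integral_independent_sample (G : set (set Om)) d' (Xi : measurableType d')
    (D : probability Xi R) (xi : Om -> Xi)
    (h : g_sigma_algebraType G -> Xi -> \bar R) :
  G `<=` measurable -> setI_closed G -> G setT ->
  measurable_fun setT xi ->
  (forall A B, G A -> measurable B -> P (A `&` xi @^-1` B) = (P A * D B)%E) ->
  measurable_fun setT (fun y : g_sigma_algebraType G * Xi => h y.1 y.2) ->
  (forall w z, 0 <= h w z)%E ->
  (\int[P]_w h w (xi w) = \int[P]_w \int[D]_z h w z)%E.
Proof.
move=> Gm GI GT mxi indep mh h0.
pose j : Om -> g_sigma_algebraType G := id.
have sGm : <<s G >> `<=` measurable by apply: smallest_sub => //; exact: sigma_algebra_measurable.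
have mj : measurable_fun setT j by move=> _ A mA; rewrite setTI; exact: sGm.
pose pr : Om -> g_sigma_algebraType G * Xi := fun w => (j w, xi w).
have mpr : measurable_fun setT pr by apply/measurable_fun_pairP.
pose jm : {mfun Om >-> g_sigma_algebraType G} :=
  HB.pack j (isMeasurableFun.Build _ _ _ _ _ mj).
pose prm : {mfun Om >-> (g_sigma_algebraType G * Xi)%type} :=
  HB.pack pr (isMeasurableFun.Build _ _ _ _ _ mpr).
have law : forall C, measurable C -> (distribution P jm \x D)%E C = distribution P prm C.
  apply: product_measure_unique => A B mA mB.
  rewrite /distribution /pushforward /=.
  have mxiB : measurable (xi @^-1` B) by rewrite -[X in measurable X]setTI; exact: mxi.
  have DB : D B \is a fin_num by exact: fin_num_measure.
  (* For fixed [B] both sides are finite measures in [A] that agree on the pi-system [G], hence on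
     the sigma-algebra it generates. *)
  pose m1 := mrestr P mxiB.
  pose m2 := mscale (NngNum (fine_ge0 (measure_ge0 D B))) P.
  have m2E C : m2 C = (P C * D B)%E by rewrite /m2 /mscale /= fineK// muleC.
  rewrite -[RHS]m2E.
  apply: (@g_sigma_algebra_measure_unique _ R Om G Gm (fun=> setT) (fun=> GT) _
    m1 m2 GI _ _ A mA).
  - by rewrite bigcup_const.
  - by move=> C GC; rewrite [RHS]m2E; exact: indep.
  - move=> _; suff : (P (setT `&` xi @^-1` B) < +oo)%E by [].
    by rewrite setTI ltey_eq fin_num_measure.
transitivity (\int[distribution P prm]_y h y.1 y.2)%E.
  by rewrite ge0_integral_pushforward// preimage_setT.
rewrite (eq_measure_integral (distribution P jm \x D)%E); last first.
  by move=> C mC _; exact: esym (law C mC).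
rewrite fubini_tonelli1//= ge0_integral_pushforward//.
- exact: measurable_fun_fubini_tonelli_F.
- by move=> w _; exact: integral_ge0.
Qed.

End Freezing.

(** * Joins of finitely many independent set systems *)

Section Cylinders.
Context d (Om : measurableType d) (R : realType) (P : probability Om R).
Context (I : choiceType) (G : I -> set_system Om).

(** If each [G i] contains the whole space and is stable under intersection, this is a pi-system
    generating the join of the [G i] for [i] in [K]. *)
Definition cylinders (K : {fset I}) : set_system Om :=
  [set A | exists2 B : I -> set Om, (forall i, i \in K -> G i (B i)) &
    A = \bigcap_(i in [set` K]) B i].

Variable K : {fset I}.
Hypothesis GT : forall i, i \in K -> G i setT.

Lemma cylinders_setT : cylinders K setT.
Proof. by exists (fun=> setT) => //; apply/seteqP; split=> // w _ i _. Qed.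

Lemma cylinders_setI : (forall i, i \in K -> setI_closed (G i)) ->
  setI_closed (cylinders K).
Proof.
move=> GI _ _ [A GA ->] [B GB ->]; exists (fun i => A i `&` B i).
  by move=> i iK; apply: GI => //; [exact: GA|exact: GB].
by rewrite bigcapI.
Qed.

Lemma sub_cylinders i : i \in K -> G i `<=` cylinders K.
Proof.
move=> iK A GA; exists (fun j => if j == i then A else setT).
  by move=> j jK; case: eqP => [->//|_]; exact: GT.
apply/seteqP; split=> [w Aw j _ /=|w /(_ i iK)]; last by rewrite eqxx.
by case: eqP.
Qed.

Lemma cylinders_independent (J : set I) (i0 : I) A C :
  (forall i, G i `<=` measurable) ->
  mutually_independent P J G -> [set` K] `<=` J -> J i0 -> i0 \notin K ->
  cylinders K A -> G i0 C -> P (A `&` C) = (P A * P C)%E.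
Proof.
move=> Gm indep KJ Ji0 i0K [B GB ->] GC.
have mK : measurable (\bigcap_(i in [set` K]) B i).
  by apply: fin_bigcap_measurable => // i iK; apply: (Gm i); exact: GB.
have mC : measurable C by exact: Gm GC.
have fin X : measurable X -> P X = (fine (P X))%:E.
  by move=> mX; rewrite fineK// fin_num_measure.
rewrite fin; last exact: measurableI.
rewrite (fin _ mK) (fin _ mC) -EFinM; congr _%:E.
(* Independence is applied twice, to [K] and to [K] enlarged by [i0]; the products differ by the
   factor of [C]. *)
pose B' i := if i == i0 then C else B i.
have neq_i0 i : i \in K -> (i == i0) = false.
  by move=> iK; apply/eqP => ii0; rewrite -ii0 iK in i0K.
rewrite (indep K B)//.
have := indep (i0 |` K)%fset B'; rewrite big_fsetU1//= /B' eqxx => indep'.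
rewrite mulrC [in RHS]big_seq_cond.
rewrite (eq_bigr (fun i => fine (P (B' i)))); last first.
  by move=> i; rewrite andbT /B' => /neq_i0 ->.
rewrite -big_seq_cond -indep'.
- congr (fine (P _)); apply/seteqP; split=> [w [Bw Cw] i|w Bw].
    rewrite /= in_fset1U; case: eqP => [_ _//|_ /= iK]; exact: Bw.
  split; last by have := Bw i0; rewrite /= in_fset1U eqxx; exact.
  move=> i iK; have := Bw i; rewrite /= in_fset1U neq_i0//=; exact.
- by move=> i; rewrite /= in_fset1U => /orP[/eqP ->//|/KJ].
- move=> i; rewrite in_fset1U; case: eqP => [-> _//|_ /= iK]; exact: GB.
Qed.

End Cylinders.

Lemma preimage_set_system_setI (T U : Type) (f : T -> U) (G : set_system U) :
  setI_closed G -> setI_closed (preimage_set_system setT f G).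
Proof.
move=> GI _ _ [A GA <-] [B GB <-]; exists (A `&` B); first exact: GI.
by rewrite !setTI preimage_setI.
Qed.

(** Conditioning on everything but one sample: [G] consists of the cylinders over the initial point
    and all other samples of the run, so functions of these are measurable for the sigma-algebra it
    generates, and the remaining sample is integrated out under its law [D]. *)
Lemma dpsvrg_sampling_freeze d (Om : measurableType d) (R : realType)
    (P : probability Om R) (p : nat) d' (Xi : measurableType d')
    (D : probability Xi R) (S m : nat) (x0 : Om -> 'cV[R]_p)
    (xi : nat -> nat -> {RV P >-> Xi}) (s t : nat) :
  dpsvrg_sampling D S m x0 xi -> (s < S)%N -> (t < m)%N ->
  exists G : set_system Om,
  [/\ random_vector (x0 : g_sigma_algebraType G -> 'cV[R]_p),
      forall s' t', (s' < S)%N -> (t' < m)%N -> (s', t') != (s, t) ->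
        measurable_fun setT (xi s' t' : g_sigma_algebraType G -> Xi) &
      forall h : g_sigma_algebraType G -> Xi -> \bar R,
        measurable_fun setT (fun y : g_sigma_algebraType G * Xi => h y.1 y.2) ->
        (forall w z, 0 <= h w z)%E ->
        (\int[P]_w h w (xi s t w) = \int[P]_w \int[D]_z h w z)%E].
Proof.
move=> [mx0 law indep] sS tm.
set Gs := dpsvrg_sigma_algebras _ _ in indep.
pose i0 : option (nat * nat) := Some (s, t).
pose K := [fset i in None :: [seq Some (s', t') | s' <- iota 0 S, t' <- iota 0 m]
  | i != i0]%fset.
have KE i : (i \in K) = (i != i0) &&
    (if i is Some (s', t') then (s' < S)%N && (t' < m)%N else true).
  rewrite !inE andbC; congr (_ && _); case: i => [[s' t']|//]; rewrite orFb.
  apply/allpairsP/andP => [[[a b] /= [+ + [-> ->]]]|[s'S t'm]].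
    by rewrite !mem_iota.
  by exists (s', t'); rewrite !mem_iota.
have Gm i : Gs i `<=` measurable.
  case: i => [[s' t'] _ [B mB <-]|]; first exact: measurable_funPT.
  apply: smallest_sub; first exact: sigma_algebra_measurable.
  move=> A; rewrite -bigcup_seq => -[j _ [B mB <-]]; exact: mx0.
have GT i : i \in K -> Gs i setT.
  case: i => [[s' t'] _|_]; first by exists setT => //; rewrite preimage_setT setTI.
  exact: (@measurableT _ (g_sigma_algebraType _)).
have GI i : i \in K -> setI_closed (Gs i).
  case: i => [[s' t'] _|_]; first by apply: preimage_set_system_setI; exact: measurableI.
  exact: (@measurableI _ (g_sigma_algebraType _)).
exists (cylinders Gs K); split.
- move=> j _ B mB; apply: sub_sigma_algebra; apply: (sub_cylinders GT (i := None)).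
    by rewrite KE.
  apply: sub_sigma_algebra; rewrite -bigcup_seq; exists j; [exact: mem_index_enum|by exists B].
- move=> s' t' s'S t'm st _ B mB; apply: sub_sigma_algebra.
  apply: (sub_cylinders GT (i := Some (s', t'))); last by exists B.
  by rewrite KE s'S t'm !andbT; apply: contraNneq st => -[-> ->].
- move=> h; apply: integral_independent_sample.
  + move=> _ [B GB ->]; apply: fin_bigcap_measurable => // i iK.
    by apply: (Gm i); exact: GB.
  + exact: cylinders_setI.
  + exact: cylinders_setT.
  + exact: measurable_funPT.
  + move=> A B GA mB.
    rewrite (cylinders_independent Gm indep (i0 := i0) _ _ _ GA).
    * by rewrite -(law s t sS tm B mB).
    * by move=> i; rewrite /= KE => /andP[_]; case: i => [[]|].
    * by rewrite /= sS tm.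
    * by rewrite KE eqxx.
    * by exists B; rewrite ?setTI.
Qed.

(** * One step of the method *)

Section OrthogonalProjection.
Context {R : realType} {p n : nat} (A : 'M[R]_(p, n)).
Local Notation P := (orth_proj A).
Implicit Types x y z : 'cV[R]_p.

Lemma orth_projE x : P x = (proj_mx (kermx A) <<A^T>>%MS)^T *m x.
Proof. by rewrite /orth_proj trmx_mul trmxK. Qed.

Lemma orth_projD x y : P (x + y) = P x + P y.
Proof. by rewrite !orth_projE mulmxDr. Qed.

Lemma orth_projZ a x : P (a *: x) = a *: P x.
Proof. by rewrite !orth_projE -scalemxAr. Qed.

Lemma orth_projB x y : P (x - y) = P x - P y.
Proof. by rewrite -scaleN1r orth_projD orth_projZ scaleN1r. Qed.

Lemma orth_proj0 : P 0 = 0.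
Proof. by rewrite orth_projE mulmx0. Qed.

Lemma orth_proj_sum (I : Type) (s : seq I) (h : I -> 'cV[R]_p) :
  P (\sum_(i <- s) h i) = \sum_(i <- s) P (h i).
Proof. by rewrite (big_morph _ orth_projD orth_proj0). Qed.

Lemma feasibleB x y : feasible A x -> feasible A y -> feasible A (x - y).
Proof. by rewrite /feasible mulmxBr => -> ->; rewrite subrr. Qed.

Lemma feasibleD x y : feasible A x -> feasible A y -> feasible A (x + y).
Proof. by rewrite /feasible mulmxDr => -> ->; rewrite addr0. Qed.

Lemma feasibleZ a x : feasible A x -> feasible A (a *: x).
Proof. by rewrite /feasible -scalemxAr => ->; rewrite scaler0. Qed.

(** [x - P x] is both feasible and orthogonal to feasible vectors, hence to itself. *)
Lemma orth_proj_id x : feasible A x -> P x = x.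
Proof.
move=> fx; apply/esym/eqP; rewrite -subr_eq0; apply/eqP/dotv_eq0.
by apply: orth_proj_orthogonal; apply: feasibleB => //; exact: orth_proj_feasible.
Qed.

Lemma dotv_orth_proj x z : feasible A z -> dotv (P x) z = dotv x z.
Proof.
move=> fz; have /eqP := orth_proj_orthogonal x fz.
by rewrite dotvDl dotvNl subr_eq0 => /eqP.
Qed.

Lemma pythagoras x :
  dotv x x = dotv (P x) (P x) + dotv (x - P x) (x - P x).
Proof.
have := orth_proj_orthogonal x (orth_proj_feasible A x).
rewrite !dotvE (dotvC (P x) x); lra.
Qed.

Lemma orth_proj_le x : dotv (P x) (P x) <= dotv x x.
Proof. by rewrite (pythagoras x) lerDl dotv_ge0. Qed.

Lemma orth_proj_compl_le x : dotv (x - P x) (x - P x) <= dotv x x.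
Proof. by rewrite (pythagoras x) lerDr dotv_ge0. Qed.

(** First-order optimality on a subspace: moving by [t *: z] stays feasible and cannot decrease [f],
    so the quadratic upper model in [t] is nonnegative. *)
Lemma constrained_minimizer_grad (L : R) (f : 'cV[R]_p -> R) xs : 0 < L ->
  (forall x y, f y <= f x + dotv (grad f x) (y - x) + L / 2 * dotv (y - x) (y - x)) ->
  constrained_minimizer A f xs ->
  forall z, feasible A z -> dotv (grad f xs) z = 0.
Proof.
move=> L0 up [fxs xs_min] z fz.
set c := dotv (grad f xs) z; pose q := dotv z z.
have q0 : 0 <= q := dotv_ge0 z.
(* Nearly the minimizer of the upper model; [q + 1] instead of [q] keeps the denominator positive
   when [z = 0]. *)
pose t := - c / (L * (q + 1)).
have := le_trans (xs_min _ (feasibleD fxs (feasibleZ t fz))) (up xs (xs + t *: z)).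
rewrite [xs + _ - xs]addrAC subrr add0r !dotvE -/c -/q => h.
have tE : t * (L * (q + 1)) = - c by rewrite /t divfK// gt_eqF// mulr_gt0//; lra.
have {}h : 0 <= t * c + L / 2 * (t * (t * q)) by lra.
rewrite (_ : c = - (t * (L * (q + 1)))) in h *; last by rewrite tE opprK.
have t0 : t ^+ 2 <= 0.
  rewrite -(@pmulr_rle0 _ (L * (q / 2 + 1))); last by rewrite mulr_gt0//; lra.
  rewrite (_ : _ * _ = - (t * - (t * (L * (q + 1))) + L / 2 * (t * (t * q)))).
    by rewrite oppr_le0.
  by field.
have /eqP -> : t == 0 by rewrite -sqrf_eq0 eq_le t0 sqr_ge0.
by rewrite mul0r oppr0.
Qed.

End OrthogonalProjection.

(** * Functions of a sample with a given mean *)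

Section Mean.
Context d (Xi : measurableType d) (R : realType) (D : probability Xi R).
Implicit Types g h : Xi -> R.

(** Integrability is carried along with the value, so that the mean of a linear combination can be
    assembled term by term. *)
Definition has_mean g (r : R) : Prop :=
  D.-integrable setT (EFin \o g) /\ \int[D]_z g z = r.

Lemma has_mean_cst r : has_mean (fun=> r) r.
Proof.
split; first exact: finite_measure_integrable_cst.
by rewrite Rintegral_cst// [X in fine X](probability_setT D) mulr1.
Qed.

Lemma has_meanD g h r s : has_mean g r -> has_mean h s ->
  has_mean (fun z => g z + h z) (r + s).
Proof.
move=> [ig <-] [ih <-]; split; last by rewrite RintegralD.
by have := integrableD measurableT ig ih; apply: eq_integrable.
Qed.

Lemma has_meanZ a g r : has_mean g r -> has_mean (fun z => a * g z) (a * r).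
Proof.
move=> [ig <-]; split; last by rewrite RintegralZl.
by have := integrableZl measurableT a ig; apply: eq_integrable.
Qed.

Lemma has_mean_sum (I : Type) (s : seq I) (g : I -> Xi -> R) (r : I -> R) :
  (forall i, has_mean (g i) (r i)) ->
  has_mean (fun z => \sum_(i <- s) g i z) (\sum_(i <- s) r i).
Proof.
move=> gr; elim: s => [|i s IHs].
  rewrite big_nil (_ : (fun _ => _) = (fun=> 0)); first exact: has_mean_cst.
  by apply/funext => z; rewrite big_nil.
rewrite big_cons (_ : (fun _ => _) = (fun z => g i z + \sum_(j <- s) g j z)).
  exact: has_meanD.
by apply/funext => z; rewrite big_cons.
Qed.

Lemma has_mean_measurable g r : has_mean g r -> measurable_fun setT g.
Proof. by move=> [/measurable_int/measurable_EFinP]. Qed.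

(** Passes from real means of a bound whose terms may have either sign to the extended-real integral
    of a nonnegative function. *)
Lemma integral_le_mean g h r : measurable_fun setT h -> (forall z, 0 <= h z) ->
  (forall z, h z <= g z) -> has_mean g r -> (\int[D]_z (h z)%:E <= r%:E)%E.
Proof.
move=> mh h0 hg gr; have [ig gE] := gr.
have <- : (\int[D]_z (g z)%:E = r%:E)%E.
  by rewrite -gE fineK//; exact: integrable_fin_num.
apply: ge0_le_integral => //.
- by move=> z _; rewrite lee_fin.
- exact: measurableT_comp.
- by apply: measurableT_comp => //; exact: has_mean_measurable gr.
- by move=> z _; rewrite lee_fin.
Qed.

Lemma has_mean_le g h r s : (forall z, g z <= h z) ->
  has_mean g r -> has_mean h s -> r <= s.
Proof.
move=> gh [ig <-] [ih <-]; by apply: le_Rintegral.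
Qed.

End Mean.

(** * From the sample functions to the objective *)

Section StochasticObjective.
Context {R : realType} {p : nat} d (Xi : measurableType d).
Context (D : probability Xi R) (F : 'cV[R]_p -> Xi -> R) (L : R).
Local Notation f := (objective D F).
Hypothesis stochF : stochastic_objective D F.
Hypothesis convF : forall z, convex_function setT (F^~ z).
Hypothesis lipF : forall z, lipschitz_grad L (F^~ z).
Hypothesis L0 : 0 < L.

Lemma sample_lower z x y : F x z + dotv (gradF F x z) (y - x) <= F y z.
Proof.
by have [dF _ _ _ _] := stochF; apply: (convex_first_order x y (dF z)).
Qed.

Lemma sample_upper z x y :
  F y z <= F x z + dotv (gradF F x z) (y - x) + L / 2 * dotv (y - x) (y - x).
Proof.
have [dF _ _ _ _] := stochF.
by apply: (descent_lemma (f := F^~ z)) => //; exact: ltW.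
Qed.

Lemma has_mean_F x : has_mean D (F x) (f x).
Proof. by have [_ iF _ _ _] := stochF; split; first exact: iF. Qed.

Lemma has_mean_grad x v :
  has_mean D (fun z => dotv (gradF F x z) v) (dotv (grad f x) v).
Proof.
have [_ _ _ ig gE] := stochF.
rewrite (_ : (fun _ => _) = (fun z => \sum_i v i 0 * gradF F x z i 0)); last first.
  by apply/funext => z; apply: eq_bigr => i _; rewrite mulrC.
rewrite (_ : dotv _ _ = \sum_i v i 0 * (\int[D]_z gradF F x z i 0)); last first.
  by rewrite gE; apply: eq_bigr => i _; rewrite mxE mulrC.
by apply: has_mean_sum => i; apply: has_meanZ; split; first exact: ig.
Qed.

Lemma random_vector_gradF x : random_vector (gradF F x).
Proof.
have [_ _ _ ig _] := stochF => i.
by have /measurable_int/measurable_EFinP := ig x i.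
Qed.

Definition bregman_sample x y z := F y z - F x z - dotv (gradF F x z) (y - x).

Lemma has_mean_bregman x y :
  has_mean D (bregman_sample x y) (f y - f x - dotv (grad f x) (y - x)).
Proof.
rewrite -[f y - f x]/(f y + - f x) -mulN1r -[X in _ - X]mul1r -mulNr.
rewrite (_ : bregman_sample x y =
  (fun z => F y z + -1 * F x z + -1 * dotv (gradF F x z) (y - x))).
  apply: has_meanD; last by apply: has_meanZ; exact: has_mean_grad.
  by apply: has_meanD; [|apply: has_meanZ]; exact: has_mean_F.
by apply/funext => z; rewrite /bregman_sample !mulN1r.
Qed.

(** The Bregman divergence of the objective is the mean of the sample divergences, which are
    nonnegative. The quadratic upper bound below is averaged in the same way. *)
Lemma objective_lower x y : f x + dotv (grad f x) (y - x) <= f y.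
Proof.
suff : 0 <= f y - f x - dotv (grad f x) (y - x) by lra.
apply: has_mean_le (has_mean_cst D 0) (has_mean_bregman x y) => z.
by have := sample_lower z x y; rewrite /bregman_sample; lra.
Qed.

Lemma objective_upper x y :
  f y <= f x + dotv (grad f x) (y - x) + L / 2 * dotv (y - x) (y - x).
Proof.
suff : f y - f x - dotv (grad f x) (y - x) <= L / 2 * dotv (y - x) (y - x) by lra.
apply: has_mean_le (has_mean_bregman x y) (has_mean_cst D _) => z.
by have := sample_upper z x y; rewrite /bregman_sample; lra.
Qed.

Lemma gradF_cocoercive x y z :
  dotv (gradF F y z - gradF F x z) (gradF F y z - gradF F x z) <=
    2 * L * bregman_sample x y z.
Proof.
by apply: (cocoercive (f := F^~ z)) => // u v; [exact: sample_lower|exact: sample_upper].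
Qed.

Lemma gradF_lipschitz x y z :
  dotv (gradF F y z - gradF F x z) (gradF F y z - gradF F x z) <=
    L ^+ 2 * dotv (y - x) (y - x).
Proof.
rewrite -!sqr_enorm -exprMn ler_pXn2r ?nnegrE ?mulr_ge0 ?enorm_ge0 ?(ltW L0)//.
by rewrite (enorm_distC y) lipF.
Qed.

End StochasticObjective.

(** * The one-step bound, first for a fixed sample and then in the mean *)

Section OneStep.
Context {R : realType} {p n : nat} (A : 'M[R]_(p, n)).
Context d (Xi : measurableType d) (D : probability Xi R).
Context (F : 'cV[R]_p -> Xi -> R) (L mu : R) (xs : 'cV[R]_p).
Local Notation f := (objective D F).
Local Notation P := (orth_proj A).
Hypothesis stochF : stochastic_objective D F.
Hypothesis convF : forall z, convex_function setT (F^~ z).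
Hypothesis lipF : forall z, lipschitz_grad L (F^~ z).
Hypothesis L0 : 0 < L.
Hypothesis mu0 : 0 <= mu.
Hypothesis scf : strongly_convex mu f.
Hypothesis minf : constrained_minimizer A f xs.

Let lower := objective_lower stochF convF.
Let upper := objective_upper stochF lipF L0.

Definition infeasibility x := dotv (x - P x) (x - P x).
Definition sqdist x := dotv (P x - xs) (P x - xs).
Definition subopt x := f (P x) - f xs.

Definition dpsvrg_step (eta : R) (b : bool) (w x : 'cV[R]_p) (z : Xi) :=
  let x' := x - eta *: (gradF F x z - gradF F w z + P (grad f w)) in
  if b then P x' else x'.

Lemma subopt_ge0 x : 0 <= subopt x.
Proof. by rewrite subr_ge0; apply: minf.2; exact: orth_proj_feasible. Qed.

(** Optimality gives P (grad f xs) = 0, so [grad f xs] may be subtracted under the projection. In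
    the co-coercivity bound the linear term vanishes because [w - xs] is feasible. *)
Lemma proj_grad_le w : feasible A w ->
  dotv (P (grad f w)) (P (grad f w)) <= 2 * L * (f w - f xs).
Proof.
move=> fw; have opt := constrained_minimizer_grad L0 upper minf.
have -> : P (grad f w) = P (grad f w - grad f xs).
  rewrite orth_projB [X in _ - X](_ : _ = 0) ?subr0//; apply: dotv_eq0.
  by rewrite dotv_orth_proj ?opt//; exact: orth_proj_feasible.
apply: (le_trans (orth_proj_le _ _)).
have := cocoercive xs w L0 lower upper.
by rewrite opt ?subr0//; apply: feasibleB => //; exact: minf.1.
Qed.

(** Adds strong convexity from [x] to [xs] and the smooth upper model from [x] to [P x]; the latter
    costs the infeasibility term. The distance shrinks under projection, so the strong convexity
    term may be stated with [sqdist]. *)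
Lemma gradient_progress x :
  subopt x + mu / 2 * sqdist x - L / 2 * infeasibility x <=
    dotv (grad f x) (P x - xs).
Proof.
have := upper x (P x); have := scf x xs.
rewrite sqr_enorm -[P x - x]opprB -[xs - x]opprB !(dotvNl, dotvNr) !opprK.
have : sqdist x <= dotv (x - xs) (x - xs).
  apply: le_trans (orth_proj_le A (x - xs)).
  by rewrite orth_projB (orth_proj_id minf.1).
move=> /(ler_wpM2l (_ : 0 <= mu / 2)) => /(_ ltac:(by rewrite divr_ge0)).
rewrite /subopt /infeasibility (_ : P x - xs = (x - xs) - (x - P x)); last first.
  by rewrite opprB addrCA addrAC subrr add0r addrC.
rewrite [X in _ -> _ -> _ -> _ <= X]dotvDr dotvNr; lra.
Qed.

Definition sample_variance_bound w x z :=
  3 * (L ^+ 2 * infeasibility x + 2 * L * bregman_sample F xs (P x) z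
    + 2 * L * bregman_sample F xs w z).

(** The gradient difference is split at [P x] and [xs]: Lipschitz continuity bounds the first piece,
    co-coercivity the two others by divergences based at [xs]. *)
Lemma sample_variance_le w x z :
  dotv (gradF F x z - gradF F w z) (gradF F x z - gradF F w z) <=
    sample_variance_bound w x z.
Proof.
rewrite (_ : gradF F x z - gradF F w z = (gradF F x z - gradF F (P x) z) +
  (gradF F (P x) z - gradF F xs z) + (gradF F xs z - gradF F w z)); last first.
  by rewrite !addrA !subrK.
apply: (le_trans (dotvD3_le _ _ _)); rewrite ler_pM2l//.
apply: lerD; first apply: lerD.
- by apply: gradF_lipschitz.
- exact: (gradF_cocoercive stochF convF lipF L0).
- rewrite -(opprB (gradF F w z)) dotvNl dotvNr opprK.
  exact: (gradF_cocoercive stochF convF lipF L0).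
Qed.

(** The linear part of a divergence averages to [dotv (grad f xs) (y - xs)], which vanishes for
    feasible [y] by optimality. This is why the splitting passes through [P x] rather than [x]. *)
Lemma has_mean_sample_variance_bound w x : feasible A w ->
  has_mean D (sample_variance_bound w x)
    (3 * (L ^+ 2 * infeasibility x + 2 * L * subopt x + 2 * L * (f w - f xs))).
Proof.
move=> fw; have opt := constrained_minimizer_grad L0 upper minf.
have breg y : feasible A y -> has_mean D (bregman_sample F xs y) (f y - f xs).
  move=> fy; have := has_mean_bregman stochF xs y.
  by rewrite opt ?subr0//; apply: feasibleB => //; exact: minf.1.
apply: has_meanZ; apply: has_meanD; last by apply: has_meanZ; exact: breg.
apply: has_meanD; first exact: has_mean_cst.
by apply: has_meanZ; apply: breg; exact: orth_proj_feasible.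
Qed.

(* The projected iterate only sees the projected gradient estimate, while the
   infeasibility grows by the unprojected noise until the next projection. *)
Lemma dpsvrg_step_pointwise eta b w x z E c c' :
  0 <= c' -> (~~ b -> c = c') -> (0 < E)%N -> feasible A w ->
  sqdist (dpsvrg_step eta b w x z) + c * infeasibility (dpsvrg_step eta b w x z) <=
    sqdist x
    - 2 * eta * (dotv (gradF F x z) (P x - xs) + -1 * dotv (gradF F w z) (P x - xs)
       + dotv (grad f w) (P x - xs))
    + (2 * eta ^+ 2 + c' * (1 + E%:R) * eta ^+ 2) * sample_variance_bound w x z
    + 2 * eta ^+ 2 * dotv (P (grad f w)) (P (grad f w))
    + c' * (1 + E%:R^-1) * infeasibility x.
Proof.
move=> c'0 cc' E0 fw; set y := dpsvrg_step eta b w x z.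
set dl := gradF F x z - gradF F w z; set h := P (grad f w).
have Ph : P h = h by apply: orth_proj_id; exact: orth_proj_feasible.
pose x' := x - eta *: (dl + h).
have Px' : P x' = P x - eta *: (P dl + h).
  by rewrite /x' orth_projB orth_projZ orth_projD Ph.
(* A projection at the end of the step leaves the feasible part unchanged. *)
have Py : P y = P x'.
  rewrite /y /dpsvrg_step -/dl -/h -/x'; case: b {cc' y} => //.
  by apply: orth_proj_id; exact: orth_proj_feasible.
have fv : feasible A (P x - xs).
  by apply: feasibleB; [exact: orth_proj_feasible|exact: minf.1].
have V := sample_variance_le w x z; rewrite -/dl in V.
have dE : sqdist y = sqdist x - 2 * eta * dotv (P dl + h) (P x - xs)
    + eta ^+ 2 * dotv (P dl + h) (P dl + h).
  rewrite /sqdist Py Px' addrAC; move: (P x - xs) (P dl + h) => v u.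
  rewrite !dotvE (dotvC u v); ring.
have hv : dotv (P dl + h) (P x - xs) = dotv (gradF F x z) (P x - xs)
   + -1 * dotv (gradF F w z) (P x - xs) + dotv (grad f w) (P x - xs).
  by rewrite dotvDl !dotv_orth_proj// /dl dotvDl dotvNl mulN1r.
have nE : dotv (P dl + h) (P dl + h) <= 2 * sample_variance_bound w x z + 2 * dotv h h.
  apply: (le_trans (dotvD_le _ _ ltr01)); rewrite invr1.
  by have := le_trans (orth_proj_le A dl) V; lra.
have qE : c * infeasibility y <= c' * (1 + E%:R^-1) * infeasibility x
    + c' * (1 + E%:R) * eta ^+ 2 * sample_variance_bound w x z.
  have Einv : 0 < (E%:R : R)^-1 by rewrite invr_gt0 ltr0n.
  have k1 : 0 <= c' * (1 + E%:R^-1) by rewrite mulr_ge0// addr_ge0// ltW.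
  have k2 : 0 <= c' * (1 + E%:R) * eta ^+ 2.
    by rewrite mulr_ge0 ?sqr_ge0// mulr_ge0// addr_ge0.
  have rhs_ge0 u v : 0 <= u -> 0 <= v ->
      0 <= c' * (1 + E%:R^-1) * u + c' * (1 + E%:R) * eta ^+ 2 * v.
    by move=> u0 v0; apply: addr_ge0; exact: mulr_ge0.
  have V0 : 0 <= sample_variance_bound w x z := le_trans (dotv_ge0 _) V.
  rewrite /infeasibility Py; rewrite /y /dpsvrg_step -/dl -/h -/x'.
  case: b cc' {y Py dE} => [_|->//].
    by rewrite subrr dotv0l mulr0; exact/rhs_ge0/V0/dotv_ge0.
  have -> : x' - P x' = (x - P x) + (- eta) *: (dl - P dl).
    rewrite Px' /x' scaleNr (_ : dl - P dl = (dl + h) - (P dl + h)); last first.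
      by rewrite opprD addrACA subrr addr0.
    rewrite scalerBr !opprB [LHS]addrACA [RHS]addrACA; congr (_ + _).
    exact: addrC.
  (* Young's inequality with parameter 1 / E: the growth factor 1 + 1 / E stays bounded when
     compounded over E steps, at the price of 1 + E on the noise. *)
  apply: (le_trans (ler_wpM2l c'0 (dotvD_le _ _ Einv))).
  rewrite invrK dotvZl dotvZr.
  have := le_trans (orth_proj_compl_le A dl) V.
  move=> /(ler_wpM2l k2).
  rewrite /infeasibility; lra.
rewrite dE hv.
have := ler_wpM2l (sqr_ge0 eta) nE.
rewrite -/h in qE *; lra.
Qed.

End OneStep.

Section OneStepMean.
Context {R : realType} {p n : nat} (A : 'M[R]_(p, n)).

Lemma random_vector_orth_proj d (T : measurableType d) (X : T -> 'cV[R]_p) :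
  random_vector X -> random_vector (fun t => orth_proj A (X t)).
Proof.
move=> mX; rewrite (_ : (fun _ => _) =
    (fun t => (proj_mx (kermx A) <<A^T>>%MS)^T *m X t)).
  exact: random_vector_mulmx.
by apply/funext => t; rewrite orth_projE.
Qed.

Lemma measurable_infeasibility d (T : measurableType d) (X : T -> 'cV[R]_p) :
  random_vector X -> measurable_fun setT (fun t => infeasibility A (X t)).
Proof.
move=> mX; apply: measurable_dotv; apply: random_vectorB => //;
  exact: random_vector_orth_proj.
Qed.

Lemma measurable_sqdist d (T : measurableType d) (X : T -> 'cV[R]_p) xs :
  random_vector X -> measurable_fun setT (fun t => sqdist A xs (X t)).
Proof.
move=> mX; apply: measurable_dotv; apply: random_vectorB;
  by [exact: random_vector_orth_proj|exact: random_vector_cst].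
Qed.

Lemma random_vector_dpsvrg_step d (T : measurableType d) d' (Xi : measurableType d')
    (D : probability Xi R) (F : 'cV[R]_p -> Xi -> R) eta b
    (W X : T -> 'cV[R]_p) (Z : T -> Xi) (G : T -> 'cV[R]_p) :
  random_vector X -> random_vector G ->
  random_vector (fun t => gradF F (X t) (Z t)) ->
  random_vector (fun t => gradF F (W t) (Z t)) ->
  (forall t, grad (objective D F) (W t) = G t) ->
  random_vector (fun t => dpsvrg_step A D F eta b (W t) (X t) (Z t)).
Proof.
move=> mX mG mgX mgW GE.
have my : random_vector (fun t => X t - eta *: (gradF F (X t) (Z t)
    - gradF F (W t) (Z t) + orth_proj A (grad (objective D F) (W t)))).
  apply: random_vectorB => //; apply: random_vectorZ; apply: random_vectorD.
    exact: random_vectorB.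
  apply: random_vector_orth_proj.
  by rewrite (_ : (fun _ => _) = G)//; apply/funext => t; exact: GE.
by case: b => //; exact: random_vector_orth_proj my.
Qed.

Context d (Xi : measurableType d) (D : probability Xi R).
Context (F : 'cV[R]_p -> Xi -> R) (L mu : R) (xs : 'cV[R]_p).
Local Notation f := (objective D F).
Local Notation P := (orth_proj A).
Hypothesis stochF : stochastic_objective D F.
Hypothesis convF : forall z, convex_function setT (F^~ z).
Hypothesis lipF : forall z, lipschitz_grad L (F^~ z).
Hypothesis L0 : 0 < L.
Hypothesis mu0 : 0 <= mu.
Hypothesis scf : strongly_convex mu f.
Hypothesis minf : constrained_minimizer A f xs.

Local Notation q := (infeasibility A).
Local Notation dist := (sqdist A xs).
Local Notation gap := (subopt A D F xs).

(** On average the sample gradient at the anchor cancels against [grad f w], leaving [grad f x], to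
    which [gradient_progress] applies. *)
Lemma dpsvrg_step_mean eta b w x E c c' :
  0 <= eta -> 0 <= c -> 0 <= c' -> (~~ b -> c = c') -> (0 < E)%N -> feasible A w ->
  (\int[D]_z (dist (dpsvrg_step A D F eta b w x z)
      + c * q (dpsvrg_step A D F eta b w x z))%:E <=
   (dist x - 2 * eta * (gap x + mu / 2 * dist x - L / 2 * q x)
    + (2 * eta ^+ 2 + c' * (1 + E%:R) * eta ^+ 2) *
      (3 * (L ^+ 2 * q x + 2 * L * gap x + 2 * L * gap w))
    + 2 * eta ^+ 2 * (2 * L * gap w) + c' * (1 + E%:R^-1) * q x)%:E)%E.
Proof.
move=> eta0 c0 c'0 cc' E0 fw.
have gw : f w - f xs = gap w by rewrite /subopt orth_proj_id.
have mstep : random_vector (dpsvrg_step A D F eta b w x).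
  have mg := random_vector_gradF stochF.
  exact: (random_vector_dpsvrg_step (G := fun=> grad f w) eta b
    (random_vector_cst x) (random_vector_cst _) (mg x) (mg w)).
have bound := fun z =>
  dpsvrg_step_pointwise stochF convF lipF L0 minf eta x z c'0 cc' E0 fw.
apply: le_trans (integral_le_mean _ _ bound _) _.
- apply: measurable_funD; first exact: measurable_sqdist.
  by apply: measurable_funM => //; exact: measurable_infeasibility.
- by move=> z; rewrite addr_ge0 ?mulr_ge0 ?dotv_ge0.
- apply: has_meanD; last exact: has_mean_cst.
  apply: has_meanD; last exact: has_mean_cst.
  apply: has_meanD; last first.
    by apply: has_meanZ; exact: (has_mean_sample_variance_bound stochF lipF L0 minf).
  apply: has_meanD; first exact: has_mean_cst.
  rewrite (_ : (fun z => - _) = (fun z => - (2 * eta) *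
     (dotv (gradF F x z) (P x - xs) + -1 * dotv (gradF F w z) (P x - xs)
       + dotv (grad f w) (P x - xs)))); last first.
    by apply/funext => z; rewrite -mulNr.
  apply: has_meanZ; apply: has_meanD; last exact: has_mean_cst.
  apply: has_meanD; first exact: has_mean_grad.
  by apply: has_meanZ; exact: has_mean_grad.
rewrite lee_fin gw; rewrite mulN1r subrK.
have := ler_wpM2l (mulr_ge0 (ler0n R 2) eta0) (gradient_progress stochF lipF L0 mu0 scf minf x).
have := ler_wpM2l (mulr_ge0 (ler0n R 2) (sqr_ge0 eta))
  (proj_grad_le stochF convF lipF L0 minf fw).
rewrite gw; lra.
Qed.

End OneStepMean.

(* [u] is 1 / E, and the factor [1 + 2 * u] pays for both the growth [1 + u] of the
   infeasibility and the contraction factor [1 - mu * eta] on the right. *)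
Lemma step_constants (R : realFieldType) (eta L mu E u c c' d q e ew : R) :
  1 <= E -> u * E = 1 -> 0 < eta -> 0 < L -> 0 <= mu <= L ->
  eta * L * E <= 1 / 60 -> 0 <= c' <= 1 / 20 ->
  c = (1 + 2 * u) * c' + 2 * (eta * L) ->
  0 <= q -> 0 <= e -> 0 <= ew ->
  d - 2 * eta * (e + mu / 2 * d - L / 2 * q)
    + (2 * eta ^+ 2 + c' * (1 + E) * eta ^+ 2) *
      (3 * (L ^+ 2 * q + 2 * L * e + 2 * L * ew))
    + 2 * eta ^+ 2 * (2 * L * ew) + c' * (1 + u) * q
  <= (1 - mu * eta) * (d + c * q) - 3 / 2 * eta * e + 1 / 2 * eta * ew.
Proof.
move=> E1 uE eta0 L0 /andP[mu0 muL] small /andP[c'0 c'1] cE q0 e0 ew0.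
set a := eta * L; have a0 : 0 < a by rewrite mulr_gt0.
have u0 : 0 < u by rewrite -(@pmulr_lgt0 _ E) ?uE//; lra.
have u1 : u <= 1 by rewrite -uE ler_peMr// ltW.
have au : a <= u / 60.
  have := ler_wpM2l (ltW u0) small.
  have -> : u * (eta * L * E) = a * (u * E) by rewrite /a; ring.
  by rewrite uE; lra.
have aE0 : 0 <= a * E by rewrite mulr_ge0//; lra.
have mua : mu * eta <= a by rewrite /a mulrC ler_pM2l.
have c0 : 0 <= c by rewrite cE addr_ge0 ?mulr_ge0//; lra.
(* [eta * V] is [L] times the coefficient of the variance bound. The bound 7 / 200 on [V] preserves
   3/2 of the progress [2 * eta * e] and charges at most [1 / 2 * eta] to [ew]. *)
pose V := a * (2 + c' * (1 + E)).
have V0 : 0 <= V by rewrite !(mulr_ge0, addr_ge0)//; lra.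
have aE : c' * (a * E) <= 1 / 20 * (1 / 60) by apply: ler_pM.
have ca : c' * a <= 1 / 20 * (1 / 60) by apply: ler_pM => //; lra.
have V1 : V <= 7 / 200 by rewrite /V; lra.
(* The coefficient of [q]: noise, smoothness cost and growth. The surplus [u * c' + a] contained in
   [c] absorbs the noise and the contraction [mu * eta <= a]. *)
have qV : 3 * (a * V) + a + c' * (1 + u) <= (1 - mu * eta) * c.
  apply: (@le_trans _ _ ((1 - a) * c)); last by rewrite ler_wpM2r// lerB.
  rewrite cE -/a.
  have h1 : c' * a <= c' * (u / 60) by rewrite ler_wpM2l.
  have h2 : c' * (a * u) <= c' * (u / 60).
    by rewrite ler_wpM2l// (le_trans _ au)// ler_piMr// ltW.
  have h3 : a * V = 2 * (a * a) + c' * (a * a) + (a * E) * (c' * a) by rewrite /V; ring.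
  have h4 : a * a <= a / 60 by rewrite ler_wpM2l// ?(ltW a0)//; lra.
  have h5 : c' * (a * a) <= c' * (u / 60).
    rewrite ler_wpM2l// (le_trans h4)//; lra.
  have h6 : (a * E) * (c' * a) <= 1 / 60 * (c' * (u / 60)) by apply: ler_pM => //; rewrite mulr_ge0// ltW.
  have h7 : 0 <= c' * u by rewrite mulr_ge0// ltW.
  rewrite h3; lra.
have := ler_wpM2r q0 qV.
have : eta * V * e <= eta * (7 / 200) * e.
  by rewrite ler_wpM2r// ler_wpM2l// ltW.
have : eta * V * ew <= eta * (7 / 200) * ew.
  by rewrite ler_wpM2r// ler_wpM2l// ltW.
have : eta * a * ew <= eta * (1 / 60) * ew.
  by rewrite ler_wpM2r// ler_wpM2l// ?(ltW eta0)//; lra.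
have ee : 0 <= eta * e by rewrite mulr_ge0// ltW.
have eew : 0 <= eta * ew by rewrite mulr_ge0// ltW.
rewrite (_ : (2 * eta ^+ 2 + c' * (1 + E) * eta ^+ 2) *
      (3 * (L ^+ 2 * q + 2 * L * e + 2 * L * ew)) =
      3 * (a * V) * q + 6 * (eta * V * e) + 6 * (eta * V * ew)); last first.
  by rewrite /V /a; ring.
rewrite (_ : 2 * eta ^+ 2 * (2 * L * ew) = 4 * (eta * a * ew)); last first.
  by rewrite /a; ring.
rewrite (_ : _ - 2 * eta * _ = d - 2 * (eta * e) - mu * eta * d + a * q); last first.
  by rewrite /a; field.
lra.
Qed.

(** * Stages *)

(** The number of steps since the last projection up to time [t], where the start of the stage
    counts as a projection. *)
Fixpoint elapsed (I : seq nat) (t : nat) : nat :=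
  if t is t'.+1 then if t'.+1 \in I then 0 else (elapsed I t').+1 else 0.

Lemma elapsed_le I t : (elapsed I t <= t)%N.
Proof. by elim: t => //= t IHt; case: ifP. Qed.

Lemma last_projection_max I t j : (j <= t)%N -> j \in I -> (j <= t - elapsed I t)%N.
Proof.
elim: t => [|t IHt] /=; first by rewrite leqn0 => /eqP ->.
rewrite leq_eqVlt => /predU1P[->|jt] jI; first by rewrite jI.
case: ifP => _; first by rewrite subn0 ltnW.
by rewrite subSS IHt.
Qed.

(** Take the first sorted time after [t], which exists because [m] is listed, and its predecessor,
    which exists because 0 is listed. The predecessor is at most the last projection time
    [t - elapsed I t], so these neighbours are more than [elapsed I t] apart. *)
Lemma elapsed_lt_gap I m t : (t < m)%N -> (elapsed I t < stage_gap m I)%N.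
Proof.
move=> tm; rewrite /stage_gap /gap; set r := sort leq _.
have mem_r j : (j \in r) = (j \in [:: 0, m & I]) by rewrite mem_sort.
have has_r : has (ltn t) r by apply/hasP; exists m; rewrite ?mem_r ?inE ?eqxx ?orbT.
pose i := find (ltn t) r.
have i_r : (i < size r)%N by rewrite -has_find.
have i_gt : (t < nth 0 r i)%N by exact: (nth_find 0 has_r).
have i0 : (0 < i)%N.
  rewrite lt0n; apply: contraTneq i_gt => i_eq0; rewrite i_eq0 -leqNgt.
  have := nth_index 0 (_ : 0 \in r); rewrite mem_r inE eqxx => /(_ isT) idx0.
  rewrite (leq_trans _ (leq0n t))// -[X in (_ <= X)%N]idx0.
  apply: (sorted_leq_nth leq_trans leqnn) => //; first exact: sort_sorted leq_total _.
    by rewrite inE -i_eq0.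
  by rewrite inE index_mem mem_r inE eqxx.
have pred_le : (nth 0 r i.-1 <= t - elapsed I t)%N.
  have le_t : (nth 0 r i.-1 <= t)%N.
    by rewrite leqNgt; apply/negbT/(before_find 0); rewrite prednK.
  have : nth 0 r i.-1 \in r by rewrite mem_nth// (leq_ltn_trans (leq_pred _)).
  rewrite mem_r !inE => /or3P[/eqP -> //|/eqP e|]; last exact: last_projection_max.
  by rewrite e leqNgt tm in le_t.
have i_ord : (i.-1 < (size r).-1)%N by rewrite -ltnS !prednK// (leq_trans _ i_r).
apply: leq_trans (leq_bigmax (Ordinal i_ord)).
rewrite /= prednK// ltn_subRL (leq_ltn_trans _ i_gt)//.
by rewrite -[X in (_ <= X)%N](subnK (elapsed_le I t)) leq_add2r.
Qed.

(** Sum the tangent inequalities at the weighted mean [c], where the linear terms cancel. The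
    weights are not normalized, to match the definition of the anchors. *)
Lemma jensen_first_order (R : realType) (p : nat) (f : 'cV[R]_p -> R) (I : finType)
    (lam : I -> R) (x : I -> 'cV[R]_p) :
  (forall x y, f x + dotv (grad f x) (y - x) <= f y) ->
  (forall i, 0 <= lam i) -> 0 < \sum_i lam i ->
  (\sum_i lam i) * f ((\sum_i lam i)^-1 *: \sum_i lam i *: x i) <=
    \sum_i lam i * f (x i).
Proof.
move=> lower lam0; set W := \sum_i lam i => W0.
set c := W^-1 *: _; have lamc : \sum_i lam i *: (x i - c) = 0.
  rewrite (eq_bigr (fun i => lam i *: x i - lam i *: c)); last first.
    by move=> i _; rewrite scalerBr.
  by rewrite sumrB -scaler_suml -/W /c scalerA divff ?gt_eqF// scale1r subrr.
have : dotv (grad f c) (\sum_i lam i *: (x i - c)) = 0 by rewrite lamc dotv0r.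
rewrite dotvC dotv_sum => sum0.
rewrite (_ : W * f c = \sum_i lam i * f c + 0); last by rewrite addr0 mulr_suml.
rewrite -[X in _ + X <= _]sum0 -big_split; apply: ler_sum => i _ /=.
by rewrite dotvZl -mulrDr ler_wpM2l// dotvC.
Qed.

(** * Measurability of the iterates *)

Section Iterates.
Context {R : realType} {p n : nat} (A : 'M[R]_(p, n)).
Context d (Xi : measurableType d) (D : probability Xi R).
Context (F : 'cV[R]_p -> Xi -> R) (L : R).
Local Notation f := (objective D F).
Hypothesis stochF : stochastic_objective D F.
Hypothesis convF : forall z, convex_function setT (F^~ z).
Hypothesis lipF : forall z, lipschitz_grad L (F^~ z).
Hypothesis L0 : 0 < L.

(** Co-coercivity followed by the quadratic upper bound; it serves to make [grad f] of a random
    vector measurable. *)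
Lemma objective_lipschitz_grad u v : enorm (grad f u - grad f v) <= L * enorm (u - v).
Proof.
have lower := objective_lower stochF convF.
have upper := objective_upper stochF lipF L0.
rewrite -(@ler_pXn2r _ 2) ?nnegrE ?mulr_ge0 ?enorm_ge0 ?(ltW L0)//.
rewrite exprMn !sqr_enorm (le_trans (cocoercive v u L0 lower upper))//.
have := ler_wpM2l (ltW (mulr_gt0 (ltr0n R 2) L0)) (upper v u); lra.
Qed.

Section Measurability.
Context dT (T : measurableType dT).

Lemma random_vector_gradF_comp (X : T -> 'cV[R]_p) (Z : T -> Xi) :
  random_vector X -> measurable_fun setT Z ->
  random_vector (fun t => gradF F (X t) (Z t)).
Proof.
move=> mX mZ i.
apply: (@measurable_fun_lipschitz _ _ _ _ _ _ (fun v z => gradF F v z i 0) L) => //.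
  by move=> v; exact: (random_vector_gradF stochF).
move=> u v z; rewrite (enorm_distC u) (le_trans _ (lipF z v u))//.
by have := le_enorm (gradF F u z - gradF F v z) i; rewrite mxE [X in _ + X]mxE.
Qed.

Lemma random_vector_grad_objective (X : T -> 'cV[R]_p) :
  random_vector X -> random_vector (fun t => grad f (X t)).
Proof.
move=> mX i.
apply: (@measurable_fun_lipschitz _ _ _ T _ _ (fun v _ => grad f v i 0) L X id) => //.
move=> u v _; apply: le_trans (objective_lipschitz_grad u v).
by have := le_enorm (grad f u - grad f v) i; rewrite mxE [X in _ + X]mxE.
Qed.

Lemma random_vector_step eta b (W X : T -> 'cV[R]_p) (Z : T -> Xi) :
  random_vector W -> random_vector X -> measurable_fun setT Z ->
  random_vector (fun t => dpsvrg_step A D F eta b (W t) (X t) (Z t)).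
Proof.
move=> mW mX mZ.
have mG := random_vector_grad_objective mW.
have mg Y := random_vector_gradF_comp (X := Y) (Z := Z) ^~ mZ.
exact: (@random_vector_dpsvrg_step _ _ _ A _ T _ Xi D F eta b W X Z
  (fun t => grad f (W t)) mX mG (mg _ mX) (mg _ mW) (fun=> erefl)).
Qed.

Variables (mu eta : R) (m : nat) (Im : seq nat).
Local Notation inner := (inner_iterate (orth_proj A) (gradF F) (grad f) eta Im).
Local Notation run := (stage (orth_proj A) (gradF F) (grad f) mu eta m Im).

Lemma random_vector_inner (W X : T -> 'cV[R]_p) (Z : nat -> T -> Xi) t :
  random_vector W -> random_vector X ->
  (forall t', (t' < t)%N -> measurable_fun setT (Z t')) ->
  random_vector (fun w => inner (W w) (X w) (Z^~ w) t).
Proof.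
move=> mW mX; elim: t => [//|t IHt] mZ.
apply: (random_vector_step eta (t.+1 \in Im) mW _ (mZ t _)) => //.
by apply: IHt => t' t't; apply: mZ; rewrite ltnS ltnW.
Qed.

Lemma random_vector_stage (x0 : T -> 'cV[R]_p) (Z : nat -> nat -> T -> Xi) s :
  random_vector x0 ->
  (forall s' t', (s' < s)%N -> (t' < m)%N -> measurable_fun setT (Z s' t')) ->
  random_vector (fun w => (run (x0 w) (fun s t => Z s t w) s).1) /\
  random_vector (fun w => (run (x0 w) (fun s t => Z s t w) s).2).
Proof.
move=> mx0; elim: s => [|s IHs] mZ.
  by split; exact: random_vector_orth_proj.
have [|mW mX] := IHs; first by move=> s' t' s's; apply: mZ; rewrite ltnS ltnW.
have minner t : (t <= m)%N -> random_vector (fun w =>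
    inner (run (x0 w) (fun s t => Z s t w) s).1 (run (x0 w) (fun s t => Z s t w) s).2
      (fun t => Z s t w) t).
  move=> tm; apply: random_vector_inner mW mX _ => t' t't.
  by apply: mZ => //; exact: leq_trans tm.
split; apply: random_vector_orth_proj; last exact: minner.
apply: random_vectorZ; apply: random_vector_sum => i; apply: random_vectorZ.
by apply: minner; rewrite -subnDA leq_subr.
Qed.

End Measurability.
End Iterates.

(** * Extended-real expectations of nonnegative functions *)

Section Ge0Expectation.
Context d (T : measurableType d) (R : realType) (P : probability T R).
Implicit Types X Y : T -> R.

Lemma integral_EFinD X Y : measurable_fun setT X -> measurable_fun setT Y ->
  (forall w, 0 <= X w) -> (forall w, 0 <= Y w) ->
  (\int[P]_w (X w + Y w)%:E = \int[P]_w (X w)%:E + \int[P]_w (Y w)%:E)%E.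
Proof.
move=> mX mY X0 Y0; under eq_integral do rewrite EFinD.
rewrite ge0_integralD//; try exact: measurableT_comp.
  by move=> w _; rewrite lee_fin.
by move=> w _; rewrite lee_fin.
Qed.

Lemma integral_EFinZ a X : measurable_fun setT X -> 0 <= a -> (forall w, 0 <= X w) ->
  (\int[P]_w (a * X w)%:E = a%:E * \int[P]_w (X w)%:E)%E.
Proof.
move=> mX a0 X0; under eq_integral do rewrite EFinM.
rewrite ge0_integralZl_EFin//; first by move=> w _; rewrite lee_fin.
exact: measurableT_comp.
Qed.

Lemma integral_EFin_le X Y : measurable_fun setT X -> measurable_fun setT Y ->
  (forall w, 0 <= X w) -> (forall w, X w <= Y w) ->
  (\int[P]_w (X w)%:E <= \int[P]_w (Y w)%:E)%E.
Proof.
move=> mX mY X0 XY; apply: ge0_le_integral => //; try exact: measurableT_comp.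
  by move=> w _; rewrite lee_fin.
by move=> w _; rewrite lee_fin.
Qed.

Lemma integral_EFin_sum (I : Type) (s : seq I) (lam : I -> R) (X : I -> T -> R) :
  (forall i, measurable_fun setT (X i)) -> (forall i, 0 <= lam i) ->
  (forall i w, 0 <= X i w) ->
  (\int[P]_w (\sum_(i <- s) lam i * X i w)%:E =
    \sum_(i <- s) (lam i)%:E * \int[P]_w (X i w)%:E)%E.
Proof.
move=> mX lam0 X0; under eq_integral do rewrite -sumEFin.
rewrite ge0_integral_sum//.
- by apply: eq_bigr => i _; rewrite integral_EFinZ.
- by move=> i; apply: measurableT_comp => //; exact: measurable_funM.
- by move=> i w _; rewrite lee_fin mulr_ge0.
Qed.

End Ge0Expectation.

Section InfeasibilityWeight.
Context {R : realType} (E : nat).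
Hypothesis E0 : (0 < E)%N.

(* The backward recursion c_k = (1 + 2 / E) c_(k+1) + 2 eta L from c_E = 0, where k
   counts the steps since the last projection and eta L = 1 / (20 e^2 E). *)
Definition infeasibility_weight (k : nat) : R :=
  (20 * expR 2)^-1 * ((1 + 2 * E%:R^-1) ^+ (E - k) - 1).

Lemma inv_20expR2_le : (20 * expR 2)^-1 <= 1 / 60 :> R.
Proof.
rewrite (_ : 1 / 60 = 60^-1) ?mul1r// lef_pV2 ?posrE ?mulr_gt0 ?expR_gt0//.
by have := expR_ge1Dx (2 : R); lra.
Qed.

Lemma infeasibility_weight_ge0 k : 0 <= infeasibility_weight k.
Proof.
by rewrite mulr_ge0 ?invr_ge0 ?mulr_ge0 ?expR_ge0// subr_ge0 exprn_ege1// lerDl mulr_ge0.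
Qed.

(** The power is at most [expR 2] because [1 + x <= expR x], and the normalization cancels exactly
    this factor. *)
Lemma infeasibility_weight_le k : infeasibility_weight k <= 1 / 20.
Proof.
have Ei : 0 <= (E%:R : R)^-1 by rewrite invr_ge0.
rewrite /infeasibility_weight mulrC ler_pdivrMr ?mulr_gt0 ?expR_gt0//.
rewrite mulrA (_ : 1 / 20 * 20 = 1) ?mul1r; last by field.
apply: (@le_trans _ _ ((1 + 2 * E%:R^-1) ^+ E)).
  apply: (@le_trans _ _ ((1 + 2 * E%:R^-1) ^+ (E - k))); first by rewrite lerBlDr lerDl.
  by apply: ler_weXn2l; [rewrite lerDl mulr_ge0|exact: leq_subr].
apply: (@le_trans _ _ (expR (2 * E%:R^-1) ^+ E)).
  by rewrite lerXn2r ?nnegrE ?expR_ge0 ?expR_ge1Dx// addr_ge0// mulr_ge0.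
by rewrite -expRM_natl -mulr_natl mulrCA divff ?mulr1// pnatr_eq0 -lt0n.
Qed.

Lemma infeasibility_weightE k : (k < E)%N ->
  infeasibility_weight k = (1 + 2 * E%:R^-1) * infeasibility_weight k.+1
    + 2 * ((20 * expR 2)^-1 * E%:R^-1).
Proof.
by move=> kE; rewrite /infeasibility_weight subnS -{1}(prednK (_ : 0 < E - k)%N)
  ?subn_gt0// exprS; ring.
Qed.

End InfeasibilityWeight.

(** * The Lyapunov function along a run *)

Section Run.
Context {R : realType} {p n : nat} (A : 'M[R]_(p, n)).
Context dXi (Xi : measurableType dXi) (D : probability Xi R).
Context (F : 'cV[R]_p -> Xi -> R) (L mu eta : R) (xs : 'cV[R]_p).
Context (E m S : nat) (Im : seq nat).
Local Notation f := (objective D F).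
Local Notation P := (orth_proj A).
Hypothesis stochF : stochastic_objective D F.
Hypothesis convF : forall z, convex_function setT (F^~ z).
Hypothesis lipF : forall z, lipschitz_grad L (F^~ z).
Hypothesis L0 : 0 < L.
Hypothesis mu0 : 0 <= mu.
Hypothesis muL : mu <= L.
Hypothesis scf : strongly_convex mu f.
Hypothesis minf : constrained_minimizer A f xs.
Hypothesis E0 : (0 < E)%N.
Hypothesis gapE : stage_gap m Im = E.
Hypothesis etaE : eta = (20 * expR 2)^-1 / (L * E%:R).

Local Notation q := (infeasibility A).
Local Notation dist := (sqdist A xs).
Local Notation gap := (subopt A D F xs).
Local Notation inner := (inner_iterate P (gradF F) (grad f) eta Im).
Local Notation run := (stage P (gradF F) (grad f) mu eta m Im).
Local Notation weight t := (infeasibility_weight E (elapsed Im t) : R).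

Section Trajectory.
Context (T : Type) (x0 : T -> 'cV[R]_p) (xi : nat -> nat -> T -> Xi).

Definition anchor s w := (run (x0 w) (fun s t => xi s t w) s).1.
Definition stage_start s w := (run (x0 w) (fun s t => xi s t w) s).2.
Definition iterate s t w :=
  inner (anchor s w) (stage_start s w) (fun t => xi s t w) t.
Definition lyapunov s t w :=
  dist (iterate s t w) + weight t * q (iterate s t w).

Lemma anchor_feasible s w : feasible A (anchor s w).
Proof. by case: s => [|s]; exact: orth_proj_feasible. Qed.

Lemma stage_start_feasible s w : feasible A (stage_start s w).
Proof. by case: s => [|s]; exact: orth_proj_feasible. Qed.

Lemma lyapunov_ge0 s t w : 0 <= lyapunov s t w.
Proof.
apply: addr_ge0; first exact: dotv_ge0.
by apply: mulr_ge0; [exact: infeasibility_weight_ge0|exact: dotv_ge0].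
Qed.

Lemma lyapunov0 s w : lyapunov s 0 w = dist (stage_start s w).
Proof.
rewrite /lyapunov /iterate /= /infeasibility (orth_proj_id (stage_start_feasible s w)).
by rewrite subrr dotv0l mulr0 addr0.
Qed.

Lemma sqdist_stage_start s w : dist (stage_start s.+1 w) <= lyapunov s m w.
Proof.
rewrite [X in dist X](_ : _ = P (iterate s m w))//.
rewrite /sqdist (orth_proj_id (orth_proj_feasible _ _)) lerDl.
by apply: mulr_ge0; [exact: infeasibility_weight_ge0|exact: dotv_ge0].
Qed.

End Trajectory.

(** Holds on any measurable space and asks only about samples already drawn, so that it also applies
    to the sigma-algebra generated by everything but the current sample. *)
Lemma random_vector_trajectory dT (T : measurableType dT) (x0 : T -> 'cV[R]_p)
    (xi : nat -> nat -> T -> Xi) s t :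
  random_vector x0 ->
  (forall s' t', (s' < s)%N -> (t' < m)%N -> measurable_fun setT (xi s' t')) ->
  (forall t', (t' < t)%N -> measurable_fun setT (xi s t')) ->
  random_vector (anchor x0 xi s) /\ random_vector (iterate x0 xi s t).
Proof.
move=> mx0 mxi mxis.
have [mW mX] := random_vector_stage A stochF convF lipF L0 mu eta Im mx0 mxi.
split=> //; exact: (random_vector_inner A stochF convF lipF L0 eta Im mW mX mxis).
Qed.

Context d (Om : measurableType d) (Pr : probability Om R).
Context (x0 : Om -> 'cV[R]_p) (xi : nat -> nat -> {RV Pr >-> Xi}).
Hypothesis sampling : dpsvrg_sampling D S m x0 xi.

Local Notation "''Ex' X" := (\int[Pr]_w (X w)%:E)%E (at level 10, X at level 8).
Local Notation W := (anchor x0 xi).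
Local Notation X := (iterate x0 xi).
Local Notation Phi := (lyapunov x0 xi).

Lemma measurable_subopt dT (T : measurableType dT) (Y : T -> 'cV[R]_p) :
  random_vector Y -> measurable_fun setT (fun w => gap (Y w)).
Proof.
move=> mY; apply: measurable_funB => //.
apply: (measurable_fun_smooth_convex L0).
- exact: objective_lower stochF convF.
- exact: objective_upper stochF lipF L0.
- exact: random_vector_orth_proj.
Qed.

Lemma random_vector_run s t : random_vector (W s) /\ random_vector (X s t).
Proof.
have [mx0 _ _] := sampling.
by apply: random_vector_trajectory => // *; exact: measurable_funPT.
Qed.

Lemma measurable_lyapunov s t : measurable_fun setT (Phi s t).
Proof.
have [_ mX] := random_vector_run s t.
apply: measurable_funD; first exact: measurable_sqdist.
by apply: measurable_funM => //; exact: measurable_infeasibility.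
Qed.

(** The next Lyapunov value with the current sample as a separate argument, ready to be integrated
    while the past is frozen. *)
Definition step_lyapunov (T : Type) (W X : T -> 'cV[R]_p) (t : nat) (w : T) (z : Xi) : R :=
  let y := dpsvrg_step A D F eta (t.+1 \in Im) (W w) (X w) z in
  dist y + weight t.+1 * q y.

Lemma step_lyapunov_ge0 (T : Type) (W X : T -> 'cV[R]_p) t w z :
  0 <= step_lyapunov W X t w z.
Proof.
apply: addr_ge0; first exact: dotv_ge0.
by apply: mulr_ge0; [exact: infeasibility_weight_ge0|exact: dotv_ge0].
Qed.

Lemma measurable_step_lyapunov dT (T : measurableType dT) (W X : T -> 'cV[R]_p) t :
  random_vector W -> random_vector X ->
  measurable_fun setT (fun y : T * Xi => (step_lyapunov W X t y.1 y.2)%:E).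
Proof.
move=> mW mX; apply: measurableT_comp => //.
have mfst (Y : T -> 'cV[R]_p) : random_vector Y ->
    random_vector (fun y : T * Xi => Y y.1).
  by move=> mY i; apply: (measurableT_comp (f := fun w => Y w i 0)).
have my := random_vector_step A stochF convF lipF L0 eta (t.+1 \in Im)
  (mfst _ mW) (mfst _ mX) (@measurable_snd _ _ T Xi).
apply: measurable_funD; first exact: measurable_sqdist my.
by apply: measurable_funM => //; exact: measurable_infeasibility my.
Qed.

Lemma eta_gt0 : 0 < eta.
Proof. by rewrite etaE divr_gt0 ?invr_gt0 ?mulr_gt0 ?expR_gt0 ?ltr0n. Qed.

Lemma eta_LE : eta * L * E%:R = (20 * expR 2)^-1.
Proof. by rewrite etaE; field; rewrite !gt_eqF ?ltr0n ?expR_gt0. Qed.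

Lemma mu_eta_le : mu * eta <= 1 / 60.
Proof.
apply: le_trans (@inv_20expR2_le R); rewrite -eta_LE.
have eta0 := ltW eta_gt0; have LE : L <= L * E%:R by rewrite ler_peMr ?ler1n// ltW.
by rewrite -mulrA [leRHS]mulrC ler_wpM2r// (le_trans muL).
Qed.

(** The one-step bound for a frozen past, whence the constant functions on [unit]. Since fewer than
    [E] steps have elapsed, the weight recursion is available. *)
Lemma step_lyapunov_mean w x t : (t < m)%N -> feasible A w ->
  (\int[D]_z (step_lyapunov (fun _ : unit => w) (fun=> x) t tt z)%:E
     + (3 / 2 * eta * gap x)%:E <=
   ((1 - mu * eta) * (dist x + weight t * q x) + 1 / 2 * eta * gap w)%:E)%E.
Proof.
move=> tm fw.
have kE : (elapsed Im t < E)%N by rewrite -gapE; exact: elapsed_lt_gap.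
have etaLE : eta * L = (20 * expR 2)^-1 * E%:R^-1.
  by rewrite etaE; field; rewrite !gt_eqF ?ltr0n ?expR_gt0.
(* Unless the step projects, the clock advances by one and the weight after the step is the next
   term of the recursion. *)
have cc' : t.+1 \notin Im -> weight t.+1 = infeasibility_weight E (elapsed Im t).+1.
  by move=> /negbTE /= ->.
have main := dpsvrg_step_mean stochF convF lipF L0 mu0 scf minf x (ltW eta_gt0)
  (infeasibility_weight_ge0 E (elapsed Im t.+1))
  (infeasibility_weight_ge0 E (elapsed Im t).+1) cc' E0 fw.
apply: le_trans (leeD2r _ main) _; rewrite -EFinD lee_fin.
have := @step_constants R eta L mu E%:R E%:R^-1 (weight t)
  (infeasibility_weight E (elapsed Im t).+1) (dist x) (q x) (gap x) (gap w).
move=> /(_ _ _ eta_gt0 L0 _ _ _ _ (dotv_ge0 _) (subopt_ge0 minf x)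
  (subopt_ge0 minf w)) const.
rewrite -lerBrDr; apply: (le_trans (const _ _ _ _ _ _)) => [||||||].
- by rewrite ler1n.
- by rewrite mulVf// gt_eqF// ltr0n.
- by rewrite mu0.
- by rewrite eta_LE inv_20expR2_le.
- by rewrite infeasibility_weight_ge0 infeasibility_weight_le.
- by rewrite etaLE infeasibility_weightE.
- lra.
Qed.

(** Freeze the past, bound the mean over the current sample pointwise, and integrate. Every term is
    nonnegative, so no expectation has to be known finite. *)
Lemma lyapunov_step s t : (s < S)%N -> (t < m)%N ->
  ('Ex (Phi s t.+1) + (3 / 2 * eta)%:E * 'Ex (fun w => gap (X s t w)) <=
   (1 - mu * eta)%:E * 'Ex (Phi s t) + (1 / 2 * eta)%:E * 'Ex (fun w => gap (W s w)))%E.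
Proof.
move=> sS tm.
have [G [mx0 mxi freeze]] := dpsvrg_sampling_freeze sampling sS tm.
pose T := g_sigma_algebraType G.
(* Anchor and iterate depend on strictly earlier samples only, hence are measurable without the
   sample of index (s, t). *)
have [mW mX] : random_vector (W s : T -> _) /\ random_vector (X s t : T -> _).
  apply: (random_vector_trajectory mx0).
    move=> s' t' s's t'm; apply: mxi => //; first exact: ltn_trans sS.
    by rewrite xpair_eqE ltn_eqF.
  move=> t' t't; apply: mxi => //; first exact: ltn_trans tm.
  by rewrite xpair_eqE [t' == t]ltn_eqF ?andbF.
have -> : 'Ex (Phi s t.+1) =
    (\int[Pr]_w \int[D]_z (step_lyapunov (W s) (X s t) t w z)%:E)%E.
  rewrite -freeze//; first exact: (measurable_step_lyapunov t mW mX).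
  by move=> w z; rewrite lee_fin step_lyapunov_ge0.
have [mW' mX'] := random_vector_run s t.
have step_ge0 w z : (0 <= (step_lyapunov (W s) (X s t) t w z)%:E)%E.
  by rewrite lee_fin step_lyapunov_ge0.
have mI : measurable_fun setT
    (fun w => \int[D]_z (step_lyapunov (W s) (X s t) t w z)%:E)%E.
  by apply: (measurable_fun_fubini_tonelli_F (fun y : Om * Xi => (step_lyapunov (W s) (X s t) t y.1 y.2)%:E));
    [exact: (measurable_step_lyapunov t mW' mX')|move=> y; exact: step_ge0].
have mgX := measurable_subopt mX'; have mgW := measurable_subopt mW'.
have mPhi := measurable_lyapunov s t.
have eta0 := eta_gt0.
have gap_ge0 Y : 0 <= gap Y := subopt_ge0 minf Y.
have mue : 0 <= 1 - mu * eta by have := mu_eta_le; lra.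
have Phi0 := lyapunov_ge0 x0 xi s t.
rewrite -[X in (_ + X)%E]integral_EFinZ//; last by rewrite mulr_ge0// ltW.
rewrite -ge0_integralD//; last 3 first.
- by move=> w _; exact: integral_ge0.
- by move=> w _; rewrite lee_fin !mulr_ge0// ltW.
- by apply: measurableT_comp => //; exact: measurable_funM.
rewrite -[X in (_ <= X + _)%E]integral_EFinZ//.
rewrite -[X in (_ <= _ + X)%E]integral_EFinZ//; last by rewrite mulr_ge0// ltW.
rewrite -integral_EFinD//; last 4 first.
- exact: measurable_funM.
- exact: measurable_funM.
- by move=> w; rewrite mulr_ge0.
- by move=> w; rewrite !mulr_ge0// ltW.
apply: ge0_le_integral => //.
- by move=> w _; rewrite adde_ge0 ?integral_ge0// lee_fin !mulr_ge0// ltW.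
- apply: emeasurable_funD => //; apply: measurableT_comp => //.
  exact: measurable_funM.
- apply: measurableT_comp => //; apply: measurable_funD; exact: measurable_funM.
- move=> w _; apply: step_lyapunov_mean => //; exact: anchor_feasible.
Qed.

(** Propagates finiteness from one step to the next, so that the recursions run on real numbers. *)
Lemma ereal_split_fin (u v : \bar R) (k r : R) : (0 <= u)%E -> (0 <= v)%E -> 0 < k ->
  (u + k%:E * v <= r%:E)%E ->
  exists u' v' : R, [/\ u = u'%:E, v = v'%:E & u' + k * v' <= r].
Proof.
move: u v => [u| |] [v| |] // u0 v0 k0; rewrite ?gt0_muley ?lte_fin//=.
by rewrite -EFinM -EFinD lee_fin => le_r; exists u, v.
Qed.

(** * Recursions within a stage and from stage to stage *)

Local Notation theta := (1 - mu * eta).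

(** Unrolls [lyapunov_step]. The newest gap has weight 1 and each older one a further factor
    [theta], which are the weights in [next_anchor]. *)
Lemma inner_recursion s (D0 e0 : R) t : (s < S)%N -> (t <= m)%N ->
  'Ex (fun w => dist (stage_start x0 xi s w)) = D0%:E ->
  'Ex (fun w => gap (W s w)) = e0%:E ->
  exists (a : R) (b : nat -> R), [/\ 'Ex (Phi s t) = a%:E,
    forall i, (i < t)%N -> 'Ex (fun w => gap (X s i w)) = (b i)%:E &
    a + 3 / 2 * eta * \sum_(i < t) theta ^+ i * b (t - i - 1)%N <=
      theta ^+ t * D0 + 1 / 2 * eta * e0 * \sum_(i < t) theta ^+ i].
Proof.
move=> sS + ED Ee; elim: t => [_|t IHt tm].
  (* No gap has been met yet, so any sequence serves. *)
  exists D0, (fun=> 0); split=> //; last by rewrite !big_ord0 expr0; lra.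
  by rewrite -ED; apply: eq_integral => w _; rewrite lyapunov0.
have [a [b [aE bE ab]]] := IHt (ltnW tm).
have := lyapunov_step sS tm; rewrite aE Ee -!EFinM -EFinD => step.
have [|||a' [b' [a'E b'E ab']]] := ereal_split_fin _ _ _ step.
- by apply: integral_ge0 => w _; rewrite lee_fin lyapunov_ge0.
- by apply: integral_ge0 => w _; rewrite lee_fin (subopt_ge0 minf).
- by rewrite mulr_gt0// eta_gt0.
exists a', (fun i => if i == t then b' else b i); split=> //.
  move=> i; rewrite ltnS leq_eqVlt; case: eqP => [-> _|_ /=]; first exact: b'E.
  exact: bE.
(* The term of index 0 is the newest gap; the remaining ones are the old sum times [theta]. *)
rewrite !big_ord_recl /= !expr0 mul1r subn0 subn1 eqxx exprS.
rewrite (eq_bigr (fun i : 'I_t => theta * (theta ^+ i * b (t - i - 1)%N))); last first.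
  move=> i _; rewrite /bump /= add1n subSS exprS mulrA ifN//.
  by rewrite -subnDA addn1 ltn_eqF// ltn_subrL (leq_ltn_trans _ (ltn_ord i)).
rewrite -mulr_sumr [X in _ * (1 + X)](eq_bigr (fun i : 'I_t => theta * theta ^+ i)); last first.
  by move=> i _; rewrite /bump /= add1n exprS.
rewrite -mulr_sumr.
have theta0 : 0 <= theta by have := mu_eta_le; lra.
have := ler_wpM2l theta0 ab; lra.
Qed.

Hypothesis m0 : (0 < m)%N.

Lemma weight_sum_ge1 : 1 <= \sum_(i < m) theta ^+ i.
Proof.
have theta0 : 0 <= theta by have := mu_eta_le; lra.
case: m m0 => // m' _; rewrite big_ord_recl expr0 lerDl sumr_ge0// => i _.
exact: exprn_ge0.
Qed.

(** By linearity the feasible part of a weighted mean is the weighted mean of the feasible parts, so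
    Jensen applies to these. *)
Lemma subopt_jensen (I : finType) (lam : I -> R) (x : I -> 'cV[R]_p) :
  (forall i, 0 <= lam i) -> 0 < \sum_i lam i ->
  (\sum_i lam i) * gap ((\sum_i lam i)^-1 *: \sum_i lam i *: x i) <=
    \sum_i lam i * gap (x i).
Proof.
move=> lam0 W0; rewrite /subopt orth_projZ orth_proj_sum.
rewrite [X in f (_ *: X)](eq_bigr (fun i => lam i *: P (x i))); last first.
  by move=> i _; rewrite orth_projZ.
rewrite mulrBr; under [leRHS]eq_bigr do rewrite mulrBr.
rewrite sumrB -mulr_suml lerB//; apply: jensen_first_order => //.
exact: objective_lower stochF convF.
Qed.

Lemma subopt_anchor s w :
  (\sum_(i < m) theta ^+ i) * gap (W s.+1 w) <=
    \sum_(i < m) theta ^+ i * gap (X s (m - i - 1) w).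
Proof.
have theta0 : 0 <= theta by have := mu_eta_le; lra.
rewrite [W s.+1 w](_ : _ = P ((\sum_(j < m) theta ^+ j)^-1 *:
  \sum_(i < m) theta ^+ i *: X s (m - i - 1) w))//.
rewrite /subopt [P (P _)]orth_proj_id; last exact: orth_proj_feasible.
apply: subopt_jensen => [i|]; first exact: exprn_ge0.
exact: lt_le_trans weight_sum_ge1.
Qed.

(** The inner recursion over a full stage: convexity bounds the gap of the new anchor by the
    weighted sum of gaps, and the final projection does not increase the Lyapunov value. *)
Lemma stage_recursion s (D0 e0 : R) : (s < S)%N ->
  'Ex (fun w => dist (stage_start x0 xi s w)) = D0%:E ->
  'Ex (fun w => gap (W s w)) = e0%:E ->
  exists D1 e1 : R, [/\ 'Ex (fun w => dist (stage_start x0 xi s.+1 w)) = D1%:E,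
    'Ex (fun w => gap (W s.+1 w)) = e1%:E &
    D1 + 3 / 2 * eta * (\sum_(i < m) theta ^+ i) * e1 <=
      theta ^+ m * D0 + 1 / 2 * eta * (\sum_(i < m) theta ^+ i) * e0].
Proof.
move=> sS ED Ee.
have theta0 : 0 <= theta by have := mu_eta_le; lra.
have W1 := weight_sum_ge1; set Wt := \sum_(i < m) _ in W1 *.
have [a [b [aE bE ab]]] := inner_recursion sS (leqnn m) ED Ee.
have gap_ge0 Y : 0 <= gap Y := subopt_ge0 minf Y.
have mX t : random_vector (X s t) by have [] := random_vector_run s t.
have mW : random_vector (W s.+1) by have [] := random_vector_run s.+1 0.
have D1a : ('Ex (fun w => dist (stage_start x0 xi s.+1 w)) <= a%:E)%E.
  rewrite -aE; apply: integral_EFin_le; last exact: sqdist_stage_start.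
  - by apply: measurable_sqdist; exact: (@random_vector_orth_proj _ _ _ A _ _ _ (mX m)).
  - exact: measurable_lyapunov.
  - by move=> w; exact: dotv_ge0.
have e1b : (Wt%:E * 'Ex (fun w => gap (W s.+1 w)) <=
    (\sum_(i < m) theta ^+ i * b (m - i - 1)%N)%:E)%E.
  have -> : ((\sum_(i < m) theta ^+ i * b (m - i - 1)%N)%:E =
      \sum_(i < m) (theta ^+ i)%:E * 'Ex (fun w => gap (X s (m - i - 1) w)))%E.
    rewrite -sumEFin; apply: eq_bigr => i _; rewrite EFinM bE//.
    by rewrite -subnDA ltn_subrL addn1 m0.
  rewrite -integral_EFin_sum//; last 2 first.
  - by move=> i; exact/measurable_subopt.
  - by move=> i; exact: exprn_ge0.
  rewrite -integral_EFinZ//; last 2 first.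
  - exact: measurable_subopt.
  - exact: le_trans W1.
  apply: integral_EFin_le; last exact: subopt_anchor.
  - by apply: measurable_funM => //; exact: measurable_subopt.
  - apply: measurable_sum => i; apply: measurable_funM => //.
    exact: measurable_subopt.
  - by move=> w; rewrite mulr_ge0// (le_trans _ W1).
have [|||D1 [e1 [D1E e1E De]]] := ereal_split_fin _ _ _ (leeD D1a e1b).
- by apply: integral_ge0 => w _; rewrite lee_fin dotv_ge0.
- by apply: integral_ge0 => w _; rewrite lee_fin.
- exact: lt_le_trans W1.
exists D1, e1; split=> //.
have eta0 := eta_gt0.
have h1 : D1 <= a by rewrite -lee_fin -D1E.
have h2 : Wt * e1 <= \sum_(i < m) theta ^+ i * b (m - i - 1)%N.
  by rewrite -lee_fin EFinM -e1E.
have h3 := ler_wpM2l (ltW eta0) h2.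
rewrite -/Wt in ab; lra.
Qed.

Lemma stage_sequences (D0 e0 : R) :
  'Ex (fun w => dist (stage_start x0 xi 0 w)) = D0%:E ->
  'Ex (fun w => gap (W 0 w)) = e0%:E ->
  exists Ds es : nat -> R, [/\ Ds 0 = D0, es 0 = e0,
    forall s, (s <= S)%N -> [/\ 'Ex (fun w => gap (W s w)) = (es s)%:E,
      0 <= Ds s & 0 <= es s] &
    forall s, (s < S)%N ->
      Ds s.+1 + 3 / 2 * eta * (\sum_(i < m) theta ^+ i) * es s.+1 <=
        theta ^+ m * Ds s + 1 / 2 * eta * (\sum_(i < m) theta ^+ i) * es s].
Proof.
move=> ED Ee.
pose ED' s := 'Ex (fun w => dist (stage_start x0 xi s w)).
pose Ee' s := 'Ex (fun w => gap (W s w)).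
have fin s : (s <= S)%N -> ED' s = (fine (ED' s))%:E /\ Ee' s = (fine (Ee' s))%:E.
  elim: s => [_|s IHs sS]; first by rewrite /ED' /Ee' ED Ee.
  have [EDs Ees] := IHs (ltnW sS).
  have [D1 [e1 [D1E e1E _]]] := stage_recursion sS EDs Ees.
  by rewrite /ED' /Ee' D1E e1E.
exists (fine \o ED'), (fine \o Ee'); split=> [||s sS|s sS] /=.
- by rewrite /ED' ED.
- by rewrite /Ee' Ee.
- have [_ Ees] := fin s sS; split=> //; apply/fine_ge0/integral_ge0 => w _.
    by rewrite lee_fin dotv_ge0.
  by rewrite lee_fin (subopt_ge0 minf).
- have [EDs Ees] := fin s (ltnW sS); have [EDs1 Ees1] := fin s.+1 sS.
  have [D1 [e1 [D1E e1E]]] := stage_recursion sS EDs Ees.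
  by rewrite /ED' /Ee' D1E e1E.
Qed.

(** * Rates over all stages *)

Hypothesis S0 : (0 < S)%N.

Local Notation yhat := (fun w =>
  dpsvrg P (gradF F) (grad f) mu eta m Im (x0 w) (fun s t => xi s t w) S).

Lemma inv_eta : eta^-1 = 20 * expR 2 * (L * E%:R).
Proof. by rewrite etaE invf_div invrK mulrC. Qed.

(** Here [theta = 1]: each stage gains 3/2 of the new gap and pays 1/2 of the old one, so the sum
    telescopes and retains each anchor gap once; Jensen passes to the averaged output. *)
Lemma convex_rate (D0 e0 : R) : mu = 0 ->
  'Ex (fun w => dist (P (x0 w))) = D0%:E ->
  'Ex (fun w => gap (P (x0 w))) = e0%:E ->
  ('Ex (fun w => gap (yhat w)) <=
    (20 * expR 2 * (L * E%:R / (m * S)%:R * D0 + S%:R^-1 * e0))%:E)%E.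
Proof.
move=> mu_eq0 ED Ee.
have [Ds [es [DsE esE Ees rec]]] := stage_sequences ED Ee.
have eta0 := eta_gt0.
have wE : \sum_(i < m) theta ^+ i = m%:R.
  rewrite (eq_bigr (fun=> 1)) ?sumr_const ?card_ord// => i _.
  by rewrite mu_eq0 mul0r subr0 expr1n.
have sum_le : eta * m%:R * \sum_(i < S) es i.+1 <= D0 + 1 / 2 * eta * m%:R * e0.
  (* The half of the latest gap kept aside pays for the anchor of the following stage. *)
  suff H s : (s <= S)%N -> Ds s + 1 / 2 * eta * m%:R * es s
      + eta * m%:R * \sum_(i < s) es i.+1 <= D0 + 1 / 2 * eta * m%:R * e0.
    apply: le_trans (H S (leqnn S)); rewrite lerDr.
    by have [_ ? ?] := Ees S (leqnn S); rewrite addr_ge0// !mulr_ge0// ltW.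
  elim: s => [_|s IHs sS]; first by rewrite big_ord0 DsE esE; lra.
  have := IHs (ltnW sS); have := rec s sS.
  rewrite wE mu_eq0 mul0r subr0 expr1n big_ord_recr /=; lra.
have SE : \sum_(i < S) (1 : R) = S%:R by rewrite sumr_const card_ord.
have Sr : 0 < (S%:R : R) by rewrite ltr0n.
have mr : 0 < (m%:R : R) by rewrite ltr0n.
have yhatE w : yhat w = S%:R^-1 *: \sum_(i < S) W i.+1 w.
  by rewrite /dpsvrg {1}mu_eq0 eqxx big_add1 big_mkord.
have gap_yhat w : gap (yhat w) <= \sum_(i < S) S%:R^-1 * gap (W i.+1 w).
  rewrite -mulr_sumr -(ler_pM2l Sr) mulrA divff ?gt_eqF// mul1r.
  have := @subopt_jensen 'I_S (fun=> 1) (fun i => W i.+1 w) (fun=> ler01).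
  rewrite SE => /(_ Sr); rewrite (eq_bigr (fun i : 'I_S => W i.+1 w)); last first.
    by move=> i _; rewrite scale1r.
  under [X in _ <= X -> _]eq_bigr do rewrite mul1r.
  by rewrite yhatE.
have mW s : random_vector (W s) by have [] := random_vector_run s 0.
have gap_ge0 Y : 0 <= gap Y := subopt_ge0 minf Y.
have myhat : random_vector yhat.
  rewrite (_ : yhat = (fun w => S%:R^-1 *: \sum_(i < S) W i.+1 w)).
    by apply: random_vectorZ; apply: random_vector_sum => i.
  by apply/funext => w; exact: yhatE.
apply: (@le_trans _ _ (\sum_(i < S) (S%:R^-1)%:E * 'Ex (fun w => gap (W i.+1 w)))%E).
  rewrite -integral_EFin_sum//.
  - apply: integral_EFin_le => //; first exact: measurable_subopt.
    apply: measurable_sum => i; apply: measurable_funM => //.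
    exact: measurable_subopt.
  - by move=> i; exact: measurable_subopt.
rewrite (eq_bigr (fun i : 'I_S => (S%:R^-1 * es i.+1)%:E)); last first.
  by move=> i _; rewrite EFinM; have [-> _ _] := Ees i.+1 (ltn_ord i).
rewrite sumEFin lee_fin -mulr_sumr -(ler_pM2l (_ : 0 < eta * m%:R * S%:R)); last first.
  by rewrite !mulr_gt0.
rewrite (_ : _ * (S%:R^-1 * _) = eta * m%:R * \sum_(i < S) es i.+1); last first.
  by field; rewrite gt_eqF.
apply: (le_trans sum_le).
have e00 : 0 <= e0 by rewrite -esE; have [_ _] := Ees 0%N (leq0n S).
(* The step size turns the coefficient of [D0] into 1, and [20 * expR 2] exceeds the 1/2 needed
   before [e0]. *)
rewrite (_ : _ * (20 * _ * _) =
  D0 + (20 * expR 2) * (eta * m%:R * e0)).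
  have t0 := mulr_ge0 (mulr_ge0 (ltW eta0) (ltW mr)) e00.
  have := ler_wpM2r t0 (expR_ge1Dx (2 : R)); lra.
rewrite natrM mulrDr mulrDr; congr (_ + _).
  by rewrite etaE; field; rewrite !gt_eqF ?ltr0n ?expR_gt0.
by field; rewrite gt_eqF.
Qed.

(** The combination [Ds s + 3 / 2 * eta * Wt * es s] contracts by [rho] at each stage: the distance
    part by [theta ^+ m], the gap part by (1/2) / (3/2) = 1/3. *)
Lemma strongly_convex_rate (D0 e0 : R) : 0 < mu ->
  'Ex (fun w => dist (P (x0 w))) = D0%:E ->
  'Ex (fun w => gap (P (x0 w))) = e0%:E ->
  ('Ex (fun w => gap (yhat w)) <=
    (20 * expR 2 * ((L * E%:R * D0 + e0) *
      expR (- ((20 * expR 2)^-1 *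
        ((m * S)%:R / Num.max (L / mu * E%:R) m%:R)))))%:E)%E.
Proof.
move=> mu_gt0 ED Ee.
have [Ds [es [DsE esE Ees rec]]] := stage_sequences ED Ee.
have eta0 := eta_gt0; have W1 := weight_sum_ge1.
have theta0 : 0 <= theta by have := mu_eta_le; lra.
set Wt := \sum_(i < m) _ in rec W1; set K := 20 * expR 2.
have K0 : 0 < K by rewrite mulr_gt0 ?expR_gt0.
have Kinv : K^-1 <= 1 / 60 := @inv_20expR2_le R.
set M := Num.max _ _.
have mM : m%:R <= M by rewrite le_max lexx orbT.
have kM : L / mu * E%:R <= M by rewrite le_max lexx.
have mr : 0 < (m%:R : R) by rewrite ltr0n.
have M0 : 0 < M := lt_le_trans mr mM.
(* As [mu * eta] is the inverse of [K] times kappa E, the bound of kappa E by [M] makes [rho]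
   dominate [theta ^+ m]; the bound of [m] by [M] keeps the exponent above -1/60, so [rho] also
   dominates 1/3. *)
pose rho : R := expR (- (K^-1 * (m%:R / M))).
have rho_theta : theta ^+ m <= rho.
  have : theta ^+ m <= expR (- (mu * eta)) ^+ m.
    by rewrite lerXn2r ?nnegrE ?expR_ge0// expR_ge1Dx.
  move=> /le_trans; apply; rewrite -expRM_natl ler_expR mulrN lerN2.
  have -> : mu * eta = K^-1 * (L / mu * E%:R)^-1.
    by rewrite etaE -/K; field; rewrite !gt_eqF ?ltr0n.
  rewrite mulrCA ler_pM2l// ler_pM2l ?invr_gt0// lef_pV2 ?posrE//.
  by rewrite mulr_gt0 ?divr_gt0 ?ltr0n.
have rho_third : 1 / 3 <= rho.
  apply: (@le_trans _ _ (1 + - (K^-1 * (m%:R / M)))); last exact: expR_ge1Dx.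
  have : K^-1 * (m%:R / M) <= 1 / 60 * 1.
    apply: ler_pM => //; rewrite ?invr_ge0 ?divr_ge0 ?(ltW K0) ?(ltW M0)//.
    by rewrite ler_pdivrMr ?mul1r.
  lra.
have contr s : (s <= S)%N -> Ds s + 3 / 2 * eta * Wt * es s <=
    rho ^+ s * (D0 + 3 / 2 * eta * Wt * e0).
  elim: s => [_|s IHs sS]; first by rewrite expr0 mul1r DsE esE.
  apply: (le_trans (rec s sS)); have [_ Ds0 es0] := Ees s (ltnW sS).
  have rho0 : 0 <= rho := expR_ge0 _.
  have := ler_wpM2l rho0 (IHs (ltnW sS)); rewrite mulrA -exprS.
  have : theta ^+ m * Ds s <= rho * Ds s by rewrite ler_wpM2r.
  have Wes : 0 <= eta * Wt * es s by rewrite !mulr_ge0 ?(ltW eta0) ?(le_trans _ W1).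
  have := ler_wpM2r Wes rho_third; lra.
rewrite (eq_integral (fun w => (gap (W S w))%:E)); last first.
  by move=> w _; rewrite /dpsvrg (gt_eqF mu_gt0).
have [-> DsS esS] := Ees S (leqnn S); rewrite lee_fin.
have rhoS : expR (- (K^-1 * ((m * S)%:R / M))) = rho ^+ S.
  by rewrite /rho -expRM_natl natrM; congr expR; ring.
rewrite rhoS -(ler_pM2l (_ : 0 < 3 / 2 * eta * Wt)); last first.
  by rewrite !mulr_gt0// (lt_le_trans _ W1).
have := contr S (leqnn S); have rhoS0 : 0 <= rho ^+ S by rewrite exprn_ge0 ?expR_ge0.
have D00 : 0 <= D0 by rewrite -DsE; have [_] := Ees 0%N (leq0n S).
have e00 : 0 <= e0 by rewrite -esE; have [_ _] := Ees 0%N (leq0n S).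
(* Division by [3 / 2 * eta * Wt] leaves the constant [K], because [eta^-1] is [K * (L * E%:R)],
   [Wt >= 1] and [K >= 1]. *)
suff : rho ^+ S * (D0 + 3 / 2 * eta * Wt * e0) <=
    3 / 2 * eta * Wt * (K * ((L * E%:R * D0 + e0) * rho ^+ S)) by lra.
rewrite [leRHS](_ : _ =
  rho ^+ S * (3 / 2 * (eta * (K * (L * E%:R))) * Wt * D0 + K * (3 / 2 * eta * Wt * e0))).
  rewrite ler_wpM2l// -inv_eta divff ?gt_eqF// mulr1; apply: lerD.
    by have := ler_wpM2r D00 W1; lra.
  rewrite ler_peMl ?mulr_ge0 ?(ltW eta0) ?(le_trans _ W1)//.
  by have := expR_ge1Dx (2 : R); rewrite /K; lra.
by ring.
Qed.

End Run.

(** * Convergence rates *)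

(** Compares the lower and upper quadratic models at 0 in a nonzero direction, which the nontrivial
    feasible subspace supplies. *)
Lemma strong_convexity_le_smoothness (R : realType) (p : nat) (mu L : R)
    (f : 'cV[R]_p -> R) (v : 'cV[R]_p) : v <> 0 -> strongly_convex mu f ->
  (forall x y, f y <= f x + dotv (grad f x) (y - x) + L / 2 * dotv (y - x) (y - x)) ->
  mu <= L.
Proof.
move=> v0 sc up; have := sc 0 v; have := up 0 v.
rewrite sqr_enorm sub0r dotvNl dotvNr opprK subr0 => h1 h2.
have vv : 0 < dotv v v.
  by rewrite lt_def dotv_ge0 andbT; apply/eqP => /dotv_eq0.
rewrite -(ler_pM2r vv); lra.
Qed.

Lemma dpsvrg_feasible (R : realType) (p n : nat) (A : 'M[R]_(p, n)) (Xi : Type)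
    (g : 'cV[R]_p -> Xi -> 'cV[R]_p) gbar mu eta m Im x0 z S :
  feasible A (dpsvrg (orth_proj A) g gbar mu eta m Im x0 z S).
Proof.
have run_feasible s : feasible A (stage (orth_proj A) g gbar mu eta m Im x0 z s).1.
  by case: s => [|s]; exact: orth_proj_feasible.
rewrite /dpsvrg; case: ifP => // _; apply: feasibleZ.
elim/big_ind: _ => //; last exact: feasibleD.
by rewrite /feasible mulmx0.
Qed.

(** Disposes of infinite initial expectations, for which the claimed bound is infinite. *)
Lemma ge0_combination_pinfty (R : realType) (u v : \bar R) (a b : R) :
  (0 <= u)%E -> (0 <= v)%E -> 0 < a -> 0 < b ->
  (a%:E * u + b%:E * v = +oo)%E \/ exists u' v' : R, u = u'%:E /\ v = v'%:E.
Proof.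
move: u v => [u| |] [v| |] // _ _ a0 b0; rewrite ?gt0_muley ?lte_fin//=.
- by right; exists u, v.
- by left.
- by left.
- by left.
Qed.

Theorem theorem4p1 (R : realType) :
  exists a b C c : R, [/\ 0 < a, 0 < b, 0 < C & 0 < c] /\
  forall (L : R) (E : nat), 0 < L -> (1 <= E)%N ->
  exists eta : R, a / (L * E%:R) <= eta <= b / (L * E%:R) /\
  forall (p n : nat) (A : 'M[R]_(p, n))
    (dXi : measure_display) (Xi : measurableType dXi) (D : probability Xi R)
    (F : 'cV[R]_p -> Xi -> R) (mu : R) (xstar : 'cV[R]_p)
    (m S : nat) (Im : seq nat)
    (dOm : measure_display) (Om : measurableType dOm) (P : probability Om R)
    (x0 : Om -> 'cV[R]_p) (xi : nat -> nat -> {RV P >-> Xi}),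
  let f := objective D F in
  let y0 := fun w => orth_proj A (x0 w) in
  let yhat := fun w =>
    dpsvrg (orth_proj A) (gradF F) (grad f) mu eta m Im
      (x0 w) (fun s t => xi s t w) S in
  let T := (m * S)%N in
  let kappa := L / mu in
  let Delta2 := ('E_P[fun w => (enorm (y0 w - xstar) ^+ 2)%R])%E in
  let gap0 := ('E_P[fun w => (f (y0 w) - f xstar)%R])%E in
  let gapS := ('E_P[fun w => (f (yhat w) - f xstar)%R])%E in
  (exists x, feasible A x /\ x <> 0) ->
  stochastic_objective D F ->
  (forall z, convex_function setT (F^~ z)) ->
  (forall z, lipschitz_grad L (F^~ z)) ->
  0 <= mu -> strongly_convex mu f ->
  constrained_minimizer A f xstar ->
  (0 < m)%N -> (0 < S)%N ->
  {subset Im <= iota 1 m} -> stage_gap m Im = E ->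
  dpsvrg_sampling D S m x0 xi ->
  (mu = 0 ->
     (gapS <= C%:E * ((L * E%:R / T%:R)%:E * Delta2 + S%:R^-1%:E * gap0))%E) /\
  (0 < mu ->
     (gapS <= C%:E * (((L * E%:R)%:E * Delta2 + gap0) *
       (expR (- (c * (T%:R / Num.max (kappa * E%:R) m%:R))))%:E))%E).
Proof.
pose K : R := 20 * expR 2.
have K0 : 0 < K by rewrite mulr_gt0 ?expR_gt0.
(* The two constants around [eta] coincide, so [eta] is fixed by [L] and [E] alone. *)
exists K^-1, K^-1, K, K^-1; split; first by rewrite invr_gt0 K0.
move=> L E L0 E0; exists (K^-1 / (L * E%:R)); split; first by rewrite lexx.
move=> p n A dXi Xi D F mu xs m S Im d Om P x0 xi f y0 yhat T kappa Delta2 gap0 gapS.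
move=> [v [_ v0]] stochF convF lipF mu0 scf minf m0 S0 _ gapE sampling.
have muL : mu <= L.
  exact: strong_convexity_le_smoothness v0 scf (objective_upper stochF lipF L0).
set eta := K^-1 / _ in yhat gapS *.
have etaE : eta = (20 * expR 2)^-1 / (L * E%:R) by [].
(* [sqdist] and [subopt] project their argument; idempotence identifies them with the quantities of
   the statement at feasible points. *)
have PP x : orth_proj A (orth_proj A x) = orth_proj A x.
  exact/orth_proj_id/orth_proj_feasible.
have Delta2E : Delta2 = (\int[P]_w (sqdist A xs (y0 w))%:E)%E.
  rewrite /Delta2 unlock; apply: eq_integral => w _.
  by rewrite sqr_enorm /sqdist PP.
have gap0E : gap0 = (\int[P]_w (subopt A D F xs (y0 w))%:E)%E.
  by rewrite /gap0 unlock; apply: eq_integral => w _; rewrite /subopt PP.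
have gapSE : gapS = (\int[P]_w (subopt A D F xs (yhat w))%:E)%E.
  rewrite /gapS unlock; apply: eq_integral => w _; rewrite /subopt orth_proj_id//.
  exact: dpsvrg_feasible.
have Delta2_ge0 : (0 <= Delta2)%E.
  by rewrite Delta2E; apply: integral_ge0 => w _; rewrite lee_fin dotv_ge0.
have gap0_ge0 : (0 <= gap0)%E.
  by rewrite gap0E; apply: integral_ge0 => w _; rewrite lee_fin (subopt_ge0 minf).
have LE0 : 0 < L * E%:R by rewrite mulr_gt0// ltr0n.
split=> [mu_eq0|mu_gt0].
- have LET0 : 0 < L * E%:R / T%:R by rewrite divr_gt0// ltr0n muln_gt0 m0.
  have Sinv0 : 0 < (S%:R : R)^-1 by rewrite invr_gt0 ltr0n.
  have [->|[D0 [e0 [D0E e0E]]]] :=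
      ge0_combination_pinfty Delta2_ge0 gap0_ge0 LET0 Sinv0.
    by rewrite gt0_muley ?lte_fin ?leey.
  rewrite D0E e0E -!EFinM gapSE.
  rewrite Delta2E in D0E; rewrite gap0E in e0E.
  exact: (convex_rate stochF convF lipF L0 mu0 muL scf minf E0 gapE etaE sampling
    m0 S0 mu_eq0 D0E e0E).
- have [|[D0 [e0 [D0E e0E]]]] :=
      ge0_combination_pinfty Delta2_ge0 gap0_ge0 LE0 (ltr01 : 0 < (1 : R)).
    rewrite mul1e => ->; rewrite gt0_mulye ?lte_fin ?expR_gt0//.
    by rewrite gt0_muley ?lte_fin ?leey.
  rewrite D0E e0E -!EFinM gapSE.
  rewrite Delta2E in D0E; rewrite gap0E in e0E.
  exact: (strongly_convex_rate stochF convF lipF L0 mu0 muL scf minf E0 gapE etaE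
    sampling m0 mu_gt0 D0E e0E).
Qed.
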